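(* Let $F|R$ be an extension of real closed fields, with canonical valuation $v$. (i) Suppose $vR$ is a convex subgroup of $vF$, and let $\tilde\iota:\mathcal C(R)\to\mathcal C(F)$ be any map constructed as follows: for a non-ball cut $C=(D,E)$ of $R$, $\tilde\iota(C)$ is one of $D^{+}_F$ or $E^{-}_F$; if $C$ is the lower edge $B_0^-$ (resp. upper edge $B_0^+$) in $R$ of a ball $B_0\neq R$ of $R$ with ball complement $(D,E)$ in $R$, then $\tilde\iota(C)=D^{+}_F$ (resp. $\tilde\iota(C)=E^{-}_F$); and $\tilde\iota$ sends the cuts $(\emptyset,R)$ and $(R,\emptyset)$ of $R$ to $R^{-}_F$ and $R^{+}_F$ respectively. Then the map $\iota:M(R(y))\to M(F(y))$ given by $\iota(\lambda_{R(y)}(\chi_R(C)))=\lambda_{F(y)}(\chi_F(\tilde\iota(C)))$ for $C\in\mathcal C(R)$ is well defined, does not depend on the choice of $\tilde\iota$, is injective, continuous and compatible with restriction. (ii) Conversely, if $\iota:M(R(y))\to M(F(y))$ is a continuous injective map compatible with restriction, then there is an injective map $\tilde\iota:\mathcal C(R)\to\mathcal C(F)$ which is continuous with respect to the full topologies and compatible with restriction of cuts, such that $\lambda_{F(y)}\circ\chi_F\circ\tilde\iota=\iota\circ\lambda_{R(y)}\circ\chi_R$; moreover, $vR$ is a convex subgroup of $vF$.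
   Context: For a field $K$, $M(K)$ is the set of $\mathbb R$-places $K\to\mathbb R\cup\{\infty\}$, with topology generated by the subbasis $H'(b)=\{\zeta\in M(K)\mid \infty\ne\zeta(b)>0\}$, $b\in K$. For an ordering $P$ of $K$, $\lambda_K(P)\in M(K)$ is the $\mathbb R$-place associated with $P$ (the place of the convex hull of $\mathbb Q$, composed with the order embedding of the residue field into $\mathbb R$). For $L|K$, $\mathrm{res}(\zeta)=\zeta|_K$; $\iota:M(K)\to M(L)$ is compatible with restriction if $\mathrm{res}\circ\iota=\mathrm{id}$. The canonical valuation $v$ of an ordered field has as valuation ring the convex hull of $\mathbb Z$. Cuts: for a totally ordered set $T$, a cut is a pair $(D,E)$ with $D<E$ (every element of $D$ below every element of $E$) and $D\cup E=T$ (the cuts $(\emptyset,T)$, $(T,\emptyset)$ included); $\mathcal C(T)$ is the set of cuts, ordered by $(D_1,E_1)<(D_2,E_2)$ iff $D_1\subsetneq D_2$. For nonempty $A\subseteq T$, $A^+=(D,T\setminus D)$ with $D$ the smallest initial segment containing $A$, and $A^-=(T\setminus E,E)$ with $E$ the smallest final segment containing $A$; for $A\subseteq R\subseteq F$, $A^{+}_F,A^{-}_F$ denote these cuts taken in $F$. The restriction of a cut $(D',E')$ of $F$ to $R$ is $(D'\cap R,E'\cap R)$; $\tilde\iota$ is compatible with restriction if restriction of $\tilde\iota(C)$ is $C$ for all $C$. Balls: for an ordered field $K$ with canonical valuation $v$, $a\in K$ and a final segment $S$ of $vK$ (possibly empty), $B_S(a,K)=\{b\in K\mid v(a-b)\in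 S\cup\{\infty\}\}$; such sets are balls. A ball complement of a ball $B$ of $K$ is a pair $(D,E)$ with $D<B<E$ and $D\cup B\cup E=K$. A cut is a ball cut if it equals $B^+$ or $B^-$ for some ball $B$ (upper/lower edge of $B$), otherwise a non-ball cut. Two cuts are equivalent if they are equal or are the lower and upper edge of the same ball. A subset of $\mathcal C(K)$ is full if closed under equivalence. The interval topology on $\mathcal C(K)$ has basic open sets $(C_1,C_2)$, $(C_1,(K,\emptyset)]$ and $[(\emptyset,K),C_2)$; the full topology consists of the full sets that are open in the interval topology. For real closed $K$, $\chi_K:\mathcal C(K)\to\{\text{orderings of }K(y)\}$ sends $(D,E)$ to the unique ordering $P$ of $K(y)$ with $D=\{d\in K\mid y-d\in P\}$; it is a bijection. *)

(* Defs.v *)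
From HB Require Import structures.
From mathcomp Require Import all_boot all_order all_algebra.
From mathcomp Require Import generic_quotient fraction.
From mathcomp Require Import boolp classical_sets reals Rstruct.
From Stdlib Require Import ClassicalEpsilon.

Set Implicit Arguments.
Unset Strict Implicit.
Unset Printing Implicit Defensive.

Import Order.TTheory GRing.Theory Num.Theory.
Local Open Scope ring_scope.
Local Open Scope classical_set_scope.

(* The field of real numbers (target of R-places); None plays the role of oo. *)
Notation RR := Rdefinitions.R.

Definition ratfun (K : fieldType) := {fraction {poly K}}.
Definition polyfrac (K : fieldType) (p : {poly K}) : ratfun K :=
  @FracField.tofrac _ p.
Definition ratvar (K : fieldType) : ratfun K := polyfrac 'X.
Definition ratconst (K : fieldType) (c : K) : ratfun K := polyfrac c%:P.

Definition ext_ratfun (R F : fieldType) (f : {rmorphism R -> F}) (x : ratfun R)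
  : ratfun F :=
  polyfrac (map_poly f \n_(repr x)) / polyfrac (map_poly f \d_(repr x)).

(* A place z : K -> R u {oo}: {x | z x <> oo} is a valuation ring A of K,
   z is a ring homomorphism on A, and z x = oo for x outside A (in which
   case x^-1 lies in the maximal ideal, i.e. z x^-1 = 0). *)
Definition is_Rplace (K : fieldType) (z : K -> option RR) : Prop :=
  z 1 = Some 1 /\
  (forall x y r s, z x = Some r -> z y = Some s ->
     z (x + y) = Some (r + s) /\ z (x * y) = Some (r * s)) /\
  (forall x, x != 0 -> z x = None -> z x^-1 = Some 0).

Definition Mset (K : fieldType) : set (K -> option RR) := [set z | is_Rplace z].
Arguments Mset K : clear implicits.

Definition Hp (K : fieldType) (b : K) : set (K -> option RR) :=
  [set z | exists r : RR, z b = Some r /\ 0 < r].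

Definition Mopen (K : fieldType) (U : set (K -> option RR)) : Prop :=
  U `<=` Mset K /\
  forall z, U z -> exists bs : seq K,
    (forall b, b \in bs -> Hp b z) /\
    (forall z', Mset K z' -> (forall b, b \in bs -> Hp b z') -> U z').

Definition Mcontinuous (K L : fieldType)
  (i : (K -> option RR) -> (L -> option RR)) : Prop :=
  forall U, Mopen U -> Mopen (Mset K `&` (i @^-1` U)).

Definition res (R F : fieldType) (f : {rmorphism R -> F})
  (z : ratfun F -> option RR) : ratfun R -> option RR :=
  fun x => z (ext_ratfun f x).

Definition is_ordering (K : fieldType) (P : set K) : Prop :=
  (forall a b, P a -> P b -> P (a + b)) /\
  (forall a b, P a -> P b -> P (a * b)) /\
  (forall a, P a \/ P (- a)) /\
  (forall a, P a -> P (- a) -> a = 0).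

(* lambda_K(P): x is finite iff it lies in the convex hull of Q w.r.t. P;
   its value is then the real number determined by the Dedekind cut of Q
   defined by x (the image of x under residue map composed with the order
   embedding of the archimedean residue field into R). *)
Definition lam (K : fieldType) (P : set K) (x : K) : option RR :=
  if `[< exists n : nat, P (n%:R - x) /\ P (x + n%:R) >] then
    Some (sup [set r : RR | exists q : rat, r = ratr q /\ P (x - ratr q)])
  else None.

(* A cut (D,E) is represented by its lower part D (an initial segment);
   E is the complement of D. *)
Definition is_initial (K : rcfType) (D : set K) : Prop :=
  forall x y, x <= y -> D y -> D x.

Definition cut (K : rcfType) := {D : set K | is_initial D}.

Definition lower (K : rcfType) (C : cut K) : set K := proj1_sig C.
Definition upper (K : rcfType) (C : cut K) : set K := ~` lower C.

Definition chi (K : rcfType) (C : cut K) : set (ratfun K) :=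
  epsilon (inhabits set0) (fun P : set (ratfun K) =>
    is_ordering P /\ lower C = [set d | P (ratvar K - ratconst d)]).

Definition is_plus_in (R F : rcfType) (f : R -> F) (A : set R) (C' : cut F) :=
  lower C' = [set x : F | exists a, A a /\ x <= f a].
Definition is_minus_in (R F : rcfType) (f : R -> F) (A : set R) (C' : cut F) :=
  lower C' = [set x : F | forall a, A a -> x < f a].

Definition cut_lt (K : rcfType) (C1 C2 : cut K) : Prop :=
  lower C1 `<=` lower C2 /\ lower C1 <> lower C2.

Definition cut_res (R F : rcfType) (f : R -> F) (C' : cut F) : set R :=
  f @^-1` lower C'.

(* vle a b  <->  v(a) <= v(b) for the canonical valuation (valuation ring =
   convex hull of Z), with v(0) = oo. *)
Definition vle (K : rcfType) (a b : K) : Prop :=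
  exists n : nat, `|b| <= n%:R * `|a|.

(* A final segment S of vK is encoded by its preimage v^-1(S), a set of
   nonzero elements of K closed upwards for v. *)
Definition is_vfinal (K : rcfType) (S : set K) : Prop :=
  (forall x, S x -> x != 0) /\
  (forall x z, S x -> z != 0 -> vle x z -> S z).

(* B_S(a,K) = {b | v(a-b) in S u {oo}} *)
Definition ball_at (K : rcfType) (S : set K) (a : K) : set K :=
  [set b | b = a \/ S (a - b)].

Definition is_ball (K : rcfType) (B : set K) : Prop :=
  exists (a : K) (S : set K), is_vfinal S /\ B = ball_at S a.

Definition ball_cut (K : rcfType) (C : cut K) : Prop :=
  exists B, is_ball B /\ (is_plus_in id B C \/ is_minus_in id B C).

Definition cut_equiv (K : rcfType) (C1 C2 : cut K) : Prop :=
  C1 = C2 \/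
  exists B, is_ball B /\
    ((is_minus_in id B C1 /\ is_plus_in id B C2) \/
     (is_plus_in id B C1 /\ is_minus_in id B C2)).

Definition full (K : rcfType) (U : set (cut K)) : Prop :=
  forall C1 C2, U C1 -> cut_equiv C1 C2 -> U C2.

Definition interval_basic (K : rcfType) (B : set (cut K)) : Prop :=
  (exists C1 C2, B = [set C | cut_lt C1 C /\ cut_lt C C2]) \/
  (exists C1, B = [set C | cut_lt C1 C]) \/
  (exists C2, B = [set C | cut_lt C C2]).

Definition interval_open (K : rcfType) (U : set (cut K)) : Prop :=
  forall C, U C -> exists B, interval_basic B /\ B C /\ B `<=` U.

Definition full_open (K : rcfType) (U : set (cut K)) : Prop :=
  full U /\ interval_open U.

Definition full_continuous (R F : rcfType) (t : cut R -> cut F) : Prop :=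
  forall U, full_open U -> full_open (t @^-1` U).

Definition vconvex (R F : rcfType) (f : {rmorphism R -> F}) : Prop :=
  forall (a : F) (b1 b2 : R), b1 != 0 -> b2 != 0 -> a != 0 ->
    vle (f b1) a -> vle a (f b2) ->
    exists c : R, c != 0 /\ vle a (f c) /\ vle (f c) a.

Definition admissible (R F : rcfType) (f : {rmorphism R -> F})
  (t : cut R -> cut F) : Prop :=
  (forall C, ~ ball_cut C ->
     is_plus_in f (lower C) (t C) \/ is_minus_in f (upper C) (t C)) /\
  (forall C B, is_ball B -> B <> setT -> is_minus_in id B C ->
     is_plus_in f (lower C) (t C)) /\
  (forall C B, is_ball B -> B <> setT -> is_plus_in id B C ->
     is_minus_in f (upper C) (t C)) /\
  (forall C, lower C = set0 -> is_minus_in f setT (t C)) /\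
  (forall C, lower C = setT -> is_plus_in f setT (t C)).

(* Main.v *)
Require Import Defs.
From HB Require Import structures.
From mathcomp Require Import all_boot all_order all_algebra.
From mathcomp Require Import generic_quotient fraction.
From mathcomp Require Import boolp classical_sets reals Rstruct.
From mathcomp Require Import ring lra polyrcf complex.
From Stdlib Require Import ClassicalEpsilon.
Import Order.TTheory GRing.Theory Num.Theory.
Local Open Scope ring_scope.
Local Open Scope classical_set_scope.

Set Implicit Arguments.
Unset Strict Implicit.
Unset Printing Implicit Defensive.

(* The ordering of K(y) attached to a cut is the sign of a rational function near
   the cut, so M(K(y)) is the quotient of the space of cuts under "same place".
   At the edges of a ball with centre a, the value of y - a is not in vK, so a
   rational function behaves like a monomial c (y - a)^k and both edges give the
   same place. Conversely, linear functions in y separate two cuts unless the gap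
   between them is closed under reflections, that is, unless it is a ball. Hence
   places are cuts up to equivalence, and the open sets of M(K(y)) are the images
   of the full open sets of cuts.

   If vR is convex in vF, the elements of F in the gap of a cut of R, or between
   the outer sides of a ball of R, again form a ball, which makes the map on places
   well defined and continuous. If conversely vR is not convex, a ball of R whose
   radius is a value of F inside a gap of vR has edges whose images in F cannot be
   approached continuously from both sides. *)

(** * Evaluation of rational functions near a cut *)

(** Since [chi] is defined by [epsilon], an explicit ordering is needed: [pos C], the functions that
    are nonnegative near the cut. Its uniqueness rests on factoring polynomials over a real closed
    field. Afterwards places are compared only through positive units: g has a positive real value
    at the place of C iff it stays between 1/(n+1) and n+1 near C for some n. The value group of
    K(y) never appears; balls are recognised by convexity and closure under point reflection. In
    (i), two admissible maps can send C to different cuts, but only to the two edges of one ball of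
    F; injectivity then comes from compatibility with restriction. In (ii), a place gives a cut of F
    only up to equivalence, and a representative may restrict to the wrong edge of a ball of R.
    Continuity excludes this, tested on principal cuts, whose classes have just two members. *)

Lemma exists_between_seqs (K : realFieldType) (s1 s2 : seq K) :
  (forall a b, a \in s1 -> b \in s2 -> a < b) ->
  exists x, (forall a, a \in s1 -> a < x) /\ (forall b, b \in s2 -> x < b).
Proof.
have ub (s : seq K) : s != [::] ->
    exists2 m, m \in s & forall a, a \in s -> a <= m.
  elim: s => // a [_ _|b s /(_ isT)[m ms mP] _].
    by exists a; rewrite ?inE // => c; rewrite inE => /eqP ->.
  case: (leP a m) => am.
    exists m; first by rewrite inE ms orbT.
    by move=> c; rewrite inE => /orP[/eqP ->//|/mP].
  exists a; first by rewrite mem_head.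
  move=> c; rewrite inE => /orP[/eqP ->//|/mP cm].
  exact: le_trans cm (ltW am).
have lb (s : seq K) : s != [::] ->
    exists2 m, m \in s & forall a, a \in s -> m <= a.
  move=> s0; have [|m ms mP] := ub (map -%R s); first by case: s s0.
  case/mapP: ms => a sa ma; exists a => // b sb.
  by move: (mP _ (map_f -%R sb)); rewrite ma lerN2.
move=> s12; have [->|s10] := eqVneq s1 [::].
  have [->|s20] := eqVneq s2 [::]; first by exists 0.
  have [m _ mP] := lb _ s20; exists (m - 1); split=> // b /mP; lra.
have [M Ms MP] := ub _ s10.
have [->|s20] := eqVneq s2 [::].
  by exists (M + 1); split=> // b /MP; lra.
have [m ms mP] := lb _ s20; have Mm := s12 _ _ Ms ms.
by exists ((M + m) / 2); split=> [a /MP|b /mP]; lra.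
Qed.

Lemma ratfunE (K : fieldType) (g : ratfun K) :
  g = polyfrac \n_(repr g) / polyfrac \d_(repr g).
Proof.
have d0 : polyfrac \d_(repr g) != 0 :> ratfun K.
  by rewrite tofrac_eq0 denom_ratioP.
apply: (mulIf d0); rewrite divfK //.
have E (r : {ratio {poly K}}) :
    \pi_{fraction {poly K}}%qT r * polyfrac \d_r = polyfrac \n_r :> ratfun K.
  rewrite /polyfrac; unlock FracField.tofrac.
  rewrite -[LHS]/(FracField.mul _ _) !piE /FracField.mulf.
  apply/eqP; rewrite FracField.equivf_def /=.
  by rewrite !numden_Ratio ?oner_neq0 ?mulr1 ?denom_ratioP // mulrC.
by rewrite -(E (repr g)) reprK.
Qed.

(** [repr] picks an unknown representative of a fraction; this cross-multiplied identity is what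
    links it to a given p/q, for evaluation as well as for [ext_ratfun]. *)
Lemma repr_frac (K : fieldType) (p q : {poly K}) : q != 0 ->
  p * \d_(repr (polyfrac p / polyfrac q)) = \n_(repr (polyfrac p / polyfrac q)) * q.
Proof.
move=> q0; have [g gE] : exists g, g = polyfrac p / polyfrac q by eexists.
rewrite -gE; have := ratfunE g; have: \d_(repr g) != 0 by rewrite denom_ratioP.
move: \n_(repr g) \d_(repr g) => n d d0 gnd.
have qf0 : polyfrac q != 0 :> ratfun K by rewrite tofrac_eq0.
have df0 : polyfrac d != 0 :> ratfun K by rewrite tofrac_eq0.
have /eqP : polyfrac (p * d) = polyfrac (n * q) :> ratfun K.
  rewrite /polyfrac !tofracM -/(polyfrac _) -/(polyfrac d) -/(polyfrac n).
  by rewrite -[polyfrac p](divfK qf0) -gE gnd mulrAC divfK.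
by rewrite tofrac_eq => /eqP.
Qed.

Section Near.
Variables (K : rcfType) (C : cut K).

Lemma lower_le x y : x <= y -> lower C y -> lower C x.
Proof. exact: (proj2_sig C). Qed.

Lemma lower_lt x y : lower C x -> ~ lower C y -> x < y.
Proof. by move=> Cx Cy; rewrite ltNge; apply/negP => /lower_le /(_ Cx). Qed.

Definition sameside (s : seq K) (x : K) :=
  forall a, a \in s -> (lower C a -> a < x) /\ (~ lower C a -> x < a).

(* The sets [sameside s] form a base of nonempty convex neighbourhoods of the
   cut: intervals (l, u) with l below and u above it, where a missing endpoint
   is infinite and an endpoint is allowed to be the maximum of the lower set or
   the minimum of the upper set. *)
Definition near (Q : K -> Prop) := exists s, forall x, sameside s x -> Q x.

Lemma nearW (Q : K -> Prop) : (forall x, Q x) -> near Q.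
Proof. by move=> QT; exists [::]. Qed.

Lemma nearI (Q1 Q2 : K -> Prop) :
  near Q1 -> near Q2 -> near (fun x => Q1 x /\ Q2 x).
Proof.
move=> [s1 P1] [s2 P2]; exists (s1 ++ s2) => x sx.
by split; [apply: P1|apply: P2] => a sa; apply: sx; rewrite mem_cat sa ?orbT.
Qed.

Lemma near1 (Q1 Q : K -> Prop) : (forall x, Q1 x -> Q x) -> near Q1 -> near Q.
Proof. by move=> QQ [s P]; exists s => x /P/QQ. Qed.

Lemma sameside_ex s : exists x, sameside s x.
Proof.
have [|x [x1 x2]] := @exists_between_seqs K [seq a <- s | `[< lower C a >]]
    [seq a <- s | ~~ `[< lower C a >]].
  move=> a b; rewrite !mem_filter => /andP[/asboolP Ca _] /andP[/asboolP Cb _].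
  exact: lower_lt.
exists x => a sa; split=> Ca; [apply: x1|apply: x2].
  by rewrite mem_filter sa andbT; apply/asboolP.
by rewrite mem_filter sa andbT; apply/asboolP.
Qed.

Lemma near_ex Q : near Q -> exists x, Q x.
Proof. by move=> [s sQ]; have [x /sQ] := sameside_ex s; exists x. Qed.

Lemma near_lower a : lower C a -> near (fun x => a < x).
Proof. by move=> Ca; exists [:: a] => x /(_ a (mem_head a [::])) [/(_ Ca)]. Qed.

Lemma near_upper a : ~ lower C a -> near (fun x => x < a).
Proof. by move=> Ca; exists [:: a] => x /(_ a (mem_head a [::])) [_ /(_ Ca)]. Qed.

Lemma near_neq a : near (fun x => x != a).
Proof.
have [Ca|Ca] := pselect (lower C a).
  by apply: near1 (near_lower Ca) => x; rewrite lt_neqAle eq_sym => /andP[].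
by apply: near1 (near_upper Ca) => x; rewrite lt_neqAle => /andP[].
Qed.

Lemma near_notin (s : seq K) : near (fun x => x \notin s).
Proof.
elim: s => [|a s IH]; first exact: nearW.
by apply: near1 (nearI (near_neq a) IH) => x [xa xs]; rewrite inE negb_or xa.
Qed.

Lemma near_nonroot (p : {poly K}) : p != 0 -> near (fun x => p.[x] != 0).
Proof.
move=> p0; apply: near1 (near_notin (rootsR p)) => x.
by have := roots_on_rootsR p0 x; rewrite inE => <-.
Qed.

(** A neighbourhood that avoids the finitely many roots is convex, so by the intermediate value
    property p has constant sign on it. *)
Lemma near_sign (p : {poly K}) :
  near (fun x => 0 <= p.[x]) \/ near (fun x => p.[x] <= 0).
Proof.
have [->|p0] := eqVneq p 0; first by left; apply: nearW => x; rewrite horner0.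
have [s sP] := near_nonroot p0; have [z zs] := sameside_ex s.
have cnv x y t : sameside s x -> sameside s y -> x <= t -> t <= y -> sameside s t.
  move=> sx sy xt ty a sa; split=> Ca.
    by apply: lt_le_trans xt; apply: (sx _ sa).1.
  by apply: le_lt_trans ty _; apply: (sy _ sa).2.
have cst x : sameside s x -> 0 <= p.[x] * p.[z].
  move=> sx; rewrite leNgt; apply/negP => pxz.
  case: (leP x z) => xz.
    have [t /andP[]] := poly_ivtoo xz pxz.
    move=> /ltW xt /ltW tz /rootP pt.
    by have := sP t (cnv _ _ _ sx zs xt tz); rewrite pt eqxx.
  rewrite mulrC in pxz; have [t /andP[]] := poly_ivtoo (ltW xz) pxz.
  move=> /ltW xt /ltW tz /rootP pt.
  by have := sP t (cnv _ _ _ zs sx xt tz); rewrite pt eqxx.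
have pz0 := sP _ zs; case: (leP 0 p.[z]) => pz; [left|right]; exists s => x /cst.
  by rewrite pmulr_lge0 // lt_def pz0.
by rewrite nmulr_lge0.
Qed.

End Near.
Arguments near {K} C Q.

(** The value depends on the representative only at zeros of a denominator, hence not near a cut:
    algebraic rules for it hold in the form [near]. *)
Definition ratfun_eval (K : fieldType) (g : ratfun K) (x : K) : K :=
  (\n_(repr g)).[x] / (\d_(repr g)).[x].

Section Positivity.
Variables (K : rcfType) (C : cut K).
Implicit Types g h : ratfun K.
Local Notation ev := (@ratfun_eval K).

Lemma eval_frac (p q : {poly K}) : q != 0 -> near C (fun x => q.[x] != 0 /\
  ev (polyfrac p / polyfrac q) x = p.[x] / q.[x]).
Proof.
move=> q0; have := repr_frac p q0; rewrite /ratfun_eval.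
have: \d_(repr (polyfrac p / polyfrac q)) != 0 by rewrite denom_ratioP.
move: (\n_ _) (\d_ _) => n d d0 pdnq.
apply: near1 (nearI (near_nonroot C q0) (near_nonroot C d0)) => x [qx dx]; split=> //.
by apply/eqP; rewrite eqr_div // -!hornerM -pdnq.
Qed.

Lemma eval_poly (p : {poly K}) : near C (fun x => ev (polyfrac p) x = p.[x]).
Proof.
have := eval_frac p (oner_neq0 _); rewrite /polyfrac tofrac1 divr1.
by apply: near1 => x [_ ->]; rewrite hornerC divr1.
Qed.

Lemma ratfun_ind (T : ratfun K -> Prop) :
  (forall p q, q != 0 -> T (polyfrac p / polyfrac q)) -> forall g, T g.
Proof. by move=> TP g; rewrite (ratfunE g); apply: TP; rewrite denom_ratioP. Qed.

Lemma evalD g h : near C (fun x => ev (g + h) x = ev g x + ev h x).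
Proof.
elim/ratfun_ind: g => p q q0; elim/ratfun_ind: h => p' q' q'0.
rewrite addf_div ?tofrac_eq0 // /polyfrac -!tofracM -tofracD.
have qq0 : q * q' != 0 by rewrite mulf_neq0.
apply: near1 (nearI (eval_frac (p * q' + p' * q) qq0) (nearI (eval_frac p q0) (eval_frac p' q'0))).
by move=> x [[_ ->] [[qx ->] [qx' ->]]]; rewrite !hornerE addf_div.
Qed.

Lemma evalM g h : near C (fun x => ev (g * h) x = ev g x * ev h x).
Proof.
elim/ratfun_ind: g => p q q0; elim/ratfun_ind: h => p' q' q'0.
rewrite mulf_div /polyfrac -!tofracM.
have qq0 : q * q' != 0 by rewrite mulf_neq0.
apply: near1 (nearI (eval_frac (p * p') qq0) (nearI (eval_frac p q0) (eval_frac p' q'0))).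
by move=> x [[_ ->] [[qx ->] [qx' ->]]]; rewrite !hornerM mulf_div.
Qed.

Lemma evalC (c : K) : near C (fun x => ev (ratconst c) x = c).
Proof. by apply: near1 (eval_poly c%:P) => x ->; rewrite hornerC. Qed.

Lemma evalN g : near C (fun x => ev (- g) x = - ev g x).
Proof.
rewrite -mulN1r; have -> : -1 = ratconst (-1) :> ratfun K.
  by rewrite /ratconst /polyfrac polyCN tofracN polyC1 tofrac1.
by apply: near1 (nearI (evalM (ratconst (-1)) g) (evalC (-1))) => x [-> ->]; rewrite mulN1r.
Qed.

Lemma evalB g h : near C (fun x => ev (g - h) x = ev g x - ev h x).
Proof. by apply: near1 (nearI (evalD g (- h)) (evalN h)) => x [-> ->]. Qed.

Lemma evalX : near C (fun x => ev (ratvar K) x = x).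
Proof. by apply: near1 (eval_poly 'X) => x ->; rewrite hornerX. Qed.

Lemma evalXB d : near C (fun x => ev (ratvar K - ratconst d) x = x - d).
Proof.
by apply: near1 (nearI (evalB (ratvar K) (ratconst d)) (nearI evalX (evalC d))) => x [-> [-> ->]].
Qed.

(* The candidate for [chi C]: the functions that are nonnegative near the cut. *)
Definition pos : set (ratfun K) := [set g | near C (fun x => 0 <= ev g x)].

Lemma pos_total g : pos g \/ near C (fun x => ev g x <= 0).
Proof.
elim/ratfun_ind: g => p q q0.
have E x : q.[x] != 0 -> (p * q).[x] / q.[x] ^+ 2 = p.[x] / q.[x].
  by move=> ?; rewrite hornerM; field.
have [pq|pq] := near_sign C (p * q); [left|right];
  apply: near1 (nearI pq (eval_frac p q0)) => x [pqx [qx ->]]; rewrite -E //.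
  by rewrite mulr_ge0 // invr_ge0 sqr_ge0.
by rewrite mulr_le0_ge0 // invr_ge0 sqr_ge0.
Qed.

Lemma pos_anti g : pos g -> near C (fun x => ev g x <= 0) -> g = 0.
Proof.
elim/ratfun_ind: g => p q q0 P1 P2.
have [->|p0] := eqVneq p 0; first by rewrite /polyfrac tofrac0 mul0r.
have [x [x1 [x2 [[qx E] px]]]] := near_ex (nearI P1 (nearI P2
  (nearI (eval_frac p q0) (near_nonroot C p0)))).
have /eqP : p.[x] / q.[x] = 0 by rewrite -E; apply: le_anti; rewrite x1 x2.
by rewrite mulf_eq0 invr_eq0 (negPf px) (negPf qx).
Qed.

Lemma pos_ordering : is_ordering pos.
Proof.
split=> [g h Pg Ph|]; last split=> [g h Pg Ph|]; last split=> [g|g Pg PNg].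
- by apply: near1 (nearI (evalD g h) (nearI Pg Ph)) => x [-> []]; apply: addr_ge0.
- by apply: near1 (nearI (evalM g h) (nearI Pg Ph)) => x [-> []]; apply: mulr_ge0.
- have [|Pg] := pos_total g; [by left|right].
  by apply: near1 (nearI Pg (evalN g)) => x [gx ->]; rewrite oppr_ge0.
- apply: pos_anti => //; apply: near1 (nearI PNg (evalN g)) => x [+ E].
  by rewrite E oppr_ge0.
Qed.

Lemma lower_pos : lower C = [set d | pos (ratvar K - ratconst d)].
Proof.
apply/seteqP; split=> d /= Pd.
  by apply: near1 (nearI (near_lower Pd) (evalXB d)) => x [dx ->]; lra.
apply: contrapT => Cd.
have [x [+ [E]]] := near_ex (nearI Pd (nearI (evalXB d) (near_upper Cd))).
by rewrite E; lra.
Qed.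

End Positivity.

(** * The real place of an ordering *)

Lemma rat_between (x y : RR) : x < y ->
  exists q : rat, x < ratr q /\ ratr q < y.
Proof. by move=> /rat_in_itvoo[q]; rewrite in_itv /= => /andP[]; exists q. Qed.

(* A copy of [K] carrying the order given by [P], so that the theory of real
   fields applies to it. *)
Definition ofield (K : fieldType) (P : set K) (HP : is_ordering P) : Type := K.

Section OrderedField.
Variables (K : fieldType) (P : set K) (HP : is_ordering P).
Local Notation L := (ofield HP).

HB.instance Definition _ := GRing.Field.copy L K.

Definition ole (x y : L) : bool := `[< P (y - x) >].
Definition onorm (x : L) : L := if ole 0 x then x else - x.

Lemma ole0D x y : ole 0 x -> ole 0 y -> ole 0 (x + y).
Proof.
rewrite /ole !subr0 => /asboolP Px /asboolP Py; apply/asboolP.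
exact: (HP.1).
Qed.

Lemma ole0M x y : ole 0 x -> ole 0 y -> ole 0 (x * y).
Proof.
rewrite /ole !subr0 => /asboolP Px /asboolP Py; apply/asboolP.
exact: (HP.2.1).
Qed.

Lemma ole0_anti x : ole 0 x -> ole x 0 -> x = 0.
Proof.
rewrite /ole subr0 sub0r => /asboolP Px /asboolP Py.
exact: (HP.2.2.2).
Qed.

Lemma osub_ge0 x y : ole 0 (y - x) = ole x y.
Proof. by rewrite /ole subr0. Qed.

Lemma ole0_total x : ole 0 x || ole x 0.
Proof.
rewrite /ole subr0 sub0r; have [Px|Px] := HP.2.2.1 x; apply/orP; [left|right];
  exact/asboolP.
Qed.

Lemma onormN x : onorm (- x) = onorm x.
Proof.
have N0 y : ole 0 (- y) = ole y 0 by rewrite /ole subr0 sub0r.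
rewrite /onorm N0 opprK; case: ifPn => x0; case: ifPn => x1 //.
  by rewrite (ole0_anti x1 x0) oppr0.
by have := ole0_total x; rewrite (negPf x0) (negPf x1).
Qed.

Lemma oge0_norm x : ole 0 x -> onorm x = x.
Proof. by rewrite /onorm => ->. Qed.

HB.instance Definition _ := Num.IntegralDomain_isLeReal.Build L
  ole0D ole0M ole0_anti osub_ge0 ole0_total onormN oge0_norm
  (fun _ _ => erefl).

Lemma ofield_le (x y : L) : (x <= y) <-> P (y - x).
Proof. by split=> [/asboolP|/asboolP]. Qed.

Lemma ofield_rat_le (x : K) q : (ratr q : L) <= x <-> P (x - ratr q).
Proof. exact: ofield_le. Qed.

Lemma ofield_le_nat (x : K) n : (x : L) <= n%:R <-> P (n%:R - x).
Proof. exact: ofield_le. Qed.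

Lemma ofield_nat_le (x : K) n : - n%:R <= (x : L) <-> P (x + n%:R).
Proof. by split=> [/ofield_le|Pn]; [|apply/ofield_le]; rewrite opprK. Qed.

Lemma ofield_natV_le (x : K) n :
  (ratr n%:R^-1 : L) <= x <-> P (x - n%:R^-1).
Proof. by rewrite fmorphV rmorph_nat; exact: ofield_le. Qed.

(** Two-sided rational approximation replaces the supremum in [lam]. The inequalities are strict in
    the reals but weak in K, where x may differ from a rational by an infinitesimal. *)
Lemma lam_SomeP (x : K) r : lam P x = Some r <->
  forall q : rat, (ratr q < r -> (ratr q : L) <= x) /\
                  (r < ratr q -> (x : L) <= ratr q).
Proof.
have EP q : (exists q' : rat, ratr q = ratr q' :> RR /\ P (x - ratr q')) <->
    (ratr q : L) <= x.
  split=> [[q' [/fmorph_inj -> Px]]|/ofield_rat_le Px]; first exact/ofield_rat_le.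
  by exists q.
have EN : (exists q' : rat, P (x - ratr q')) ->
    [set r : RR | exists q : rat, r = ratr q /\ P (x - ratr q)] !=set0.
  by move=> [q' Px]; exists (ratr q'), q'.
split.
  rewrite /lam; case: asboolP => // -[n [Pn1 Pn2]] []; set E := [set _ | _] => rE q.
  have xn : (x : L) <= n%:R by apply/ofield_le_nat.
  have nx : - n%:R <= (x : L) by apply/ofield_nat_le.
  have ubE : has_sup E.
    split.
      apply: EN; exists (- n%:R); apply/ofield_rat_le.
      by rewrite rmorphN rmorph_nat.
    exists n%:R => _ [q' [-> /ofield_rat_le q'x]].
    rewrite -(ratr_nat RR) ler_rat -(ler_rat L) ratr_nat.
    exact: le_trans q'x xn.
  rewrite -rE; split=> [/(sup_gt ubE.1) [_ [q' [-> /ofield_rat_le q'x]]]|rq].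
    by rewrite ltr_rat -(ltr_rat L) => /ltW /le_trans; apply.
  rewrite leNgt; apply/negP => /ltW/EP Eq.
  by have := sup_upper_bound ubE Eq; rewrite leNgt rq.
move=> rP.
have [q1 [rq1 q1r]] := rat_between (ltac:(lra) : r - 1 < r).
have [q2 [rq2 q2r]] := rat_between (ltac:(lra) : r < r + 1).
have [n nq] : exists n : nat, - n%:R <= q1 /\ q2 <= n%:R.
  exists (maxn (Num.bound q1) (Num.bound q2)); split.
    rewrite lerNl; apply: le_trans (ler_norm _) _; rewrite normrN.
    apply: ltW; apply: lt_le_trans (archi_boundP (normr_ge0 _)) _.
    by rewrite ler_nat /Num.bound normr_id leq_maxl.
  apply: le_trans (ler_norm _) _.
  apply: ltW; apply: lt_le_trans (archi_boundP (normr_ge0 _)) _.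
  by rewrite ler_nat /Num.bound normr_id leq_maxr.
have xn : (x : L) <= n%:R.
  by rewrite -(ratr_nat L); apply: le_trans ((rP q2).2 _) _ => //; rewrite ler_rat nq.2.
have nx : - n%:R <= (x : L).
  rewrite -(ratr_nat L) -rmorphN; apply: le_trans ((rP q1).1 _) => //.
  by rewrite ler_rat nq.1.
rewrite /lam; case: asboolP => [_|[]]; last first.
  by exists n; split; [apply/ofield_le_nat|apply/ofield_nat_le].
congr Some; set E := [set _ | _].
have ubE r' : E r' -> r' <= r.
  move=> [q [-> /ofield_rat_le qx]]; rewrite leNgt; apply/negP => rq.
  have [q' [rq' q'q]] := rat_between rq.
  have := le_trans qx ((rP q').2 rq'); rewrite ler_rat leNgt.
  by rewrite -(ltr_rat RR) q'q.
have E0 : E !=set0 by exists (ratr q1); apply/EP; apply: (rP q1).1.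
apply: le_anti; rewrite ge_sup //= leNgt; apply/negP => Er.
have [q [Eq qr]] := rat_between Er.
have Eq' : E (ratr q) by apply/EP; apply: (rP q).1.
have hE : has_sup E by split=> //; exists r.
by have := sup_upper_bound hE Eq'; rewrite leNgt Eq.
Qed.

Lemma lam_NoneP (x : K) : lam P x = None <-> forall n : nat, n%:R < `|x : L|.
Proof.
rewrite /lam; case: asboolP => [[n [Pn1 Pn2]]|nP]; split=> //.
  move=> /(_ n); rewrite ltNge ler_norml.
  have -> : - n%:R <= (x : L) by apply/ofield_nat_le.
  by have -> : (x : L) <= n%:R by apply/ofield_le_nat.
move=> _ n; rewrite ltNge; apply/negP; rewrite ler_norml => /andP[nx xn].
by apply: nP; exists n; split; [apply/ofield_le_nat|apply/ofield_nat_le].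
Qed.

Lemma lam_NoneVSome x : lam P x = None \/ exists r, lam P x = Some r.
Proof. by case: (lam P x) => [r|]; [right; exists r|left]. Qed.

Lemma lamN x r : lam P x = Some r -> lam P (- x) = Some (- r).
Proof.
move=> /lam_SomeP xr; apply/lam_SomeP => q; split=> qr.
  by have := (xr (- q)).2; rewrite !rmorphN lerNr; apply; lra.
by have := (xr (- q)).1; rewrite !rmorphN lerNl; apply; lra.
Qed.

Lemma lamD x y r s :
  lam P x = Some r -> lam P y = Some s -> lam P (x + y) = Some (r + s).
Proof.
move=> /lam_SomeP xr /lam_SomeP ys; apply/lam_SomeP => q; split=> qr.
  have [q1 [qs q1r]] := rat_between (ltac:(lra) : ratr q - s < r).
  have := (xr q1).1 q1r; have := (ys (q - q1)).1; rewrite !rmorphB.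
  by move=> /(_ ltac:(lra)); set a := ratr q1; set b := ratr q; lra.
have [q1 [qs q1r]] := rat_between (ltac:(lra) : r < ratr q - s).
have := (xr q1).2 qs; have := (ys (q - q1)).2; rewrite !rmorphB.
by move=> /(_ ltac:(lra)); set a := ratr q1; set b := ratr q; lra.
Qed.

(** Squares are treated first because only the sign of x matters, and a change of sign reduces to r
    >= 0; general products then follow by polarisation. *)
Lemma lam_sqr x r : lam P x = Some r -> lam P (x ^+ 2) = Some (r ^+ 2).
Proof.
wlog r0 : x r / 0 <= r => [wl|] xr.
  case: (leP 0 r) => [|r0]; first by move/wl; apply.
  rewrite -sqrrN -[in RHS]sqrrN; apply: wl; last exact: lamN.
  by lra.
move/lam_SomeP in xr; apply/lam_SomeP => q; split=> qr.
  have [q0|q0] := leP q 0.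
    by apply: (@le_trans _ L 0); [rewrite lerq0|exact: sqr_ge0].
  have q0' : 0 < (ratr q : RR) by rewrite ltr0q.
  have sq : Num.sqrt (ratr q) < r.
    by rewrite -(ltr_pXn2r (n := 2)) ?nnegrE ?sqrtr_ge0 // sqr_sqrtr // ltW.
  have [q1 [qs q1r]] := rat_between sq.
  have q10 : 0 <= q1.
    by rewrite -(ler0q RR); apply: le_trans (ltW qs); exact: sqrtr_ge0.
  have qq1 : q <= q1 ^+ 2.
    rewrite -(ler_rat RR) rmorphXn -[ratr q]sqr_sqrtr ?(ltW q0') //.
    by rewrite lerXn2r ?nnegrE ?sqrtr_ge0 ?ler0q // ltW.
  apply: (@le_trans _ L (ratr (q1 ^+ 2))); first by rewrite ler_rat.
  have q1x : (ratr q1 : L) <= x := (xr q1).1 q1r.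
  have q1L : 0 <= (ratr q1 : L) by rewrite ler0q.
  by rewrite rmorphXn; apply: lerXn2r; rewrite ?nnegrE //; apply: le_trans q1x.
have q0' : 0 < (ratr q : RR) by apply: le_lt_trans qr; exact: sqr_ge0.
have sq : r < Num.sqrt (ratr q).
  by rewrite -(ltr_pXn2r (n := 2)) ?nnegrE ?sqrtr_ge0 // sqr_sqrtr // ltW.
have [q1 [qs q1r]] := rat_between sq.
have q10 : 0 <= q1 by rewrite -(ler0q RR); apply: le_trans r0 (ltW qs).
have qq1 : q1 ^+ 2 <= q.
  rewrite -(ler_rat RR) rmorphXn -[ratr q in leRHS]sqr_sqrtr ?(ltW q0') //.
  by rewrite lerXn2r ?nnegrE ?sqrtr_ge0 ?ler0q // ltW.
apply: (@le_trans _ L (ratr (q1 ^+ 2))); last by rewrite ler_rat.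
have x1 : (x : L) <= ratr q1 := (xr q1).2 qs.
(* For r = 0 the element x can be a negative infinitesimal, so x^2 <= q1^2 needs a lower bound on x
   as well. *)
have x2 : - ratr q1 <= (x : L).
  rewrite -rmorphN; have [r00|r00] := eqVneq r 0; last first.
    by apply: (xr _).1; rewrite rmorphN; lra.
  by apply: (xr _).1; rewrite rmorphN; lra.
rewrite rmorphXn -subr_ge0 subr_sqr mulr_ge0 //;
  by set a := ratr q1 in x1 x2 *; set b : L := x in x1 x2 *; lra.
Qed.

Lemma lam1 : lam P 1 = Some 1.
Proof.
apply/lam_SomeP => q.
have := (ltr_rat RR q 1, ltr_rat RR 1 q, ler_rat L q 1, ler_rat L 1 q).
by rewrite !rmorph1 => E; rewrite !E; split=> /ltW.
Qed.

Lemma lam_half x r : lam P (x + x) = Some r -> lam P x = Some (r / 2).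
Proof.
move=> /lam_SomeP xr; apply/lam_SomeP => q; have := xr (q + q).
rewrite !rmorphD /=; set a := ratr q; set b := ratr q; move=> [h1 h2].
by split=> qr; [have := h1 ltac:(lra)|have := h2 ltac:(lra)]; lra.
Qed.

Lemma lamM x y r s :
  lam P x = Some r -> lam P y = Some s -> lam P (x * y) = Some (r * s).
Proof.
move=> xr ys; have := lam_sqr (lamD xr ys).
move=> /lamD/(_ (lamN (lam_sqr xr)))/lamD/(_ (lamN (lam_sqr ys))).
have -> : (x + y) ^+ 2 - x ^+ 2 - y ^+ 2 = x * y + x * y by ring.
by move/lam_half => ->; congr Some; field.
Qed.

Lemma lamV x : x != 0 -> lam P x = None -> lam P x^-1 = Some 0.
Proof.
move=> x0 /lam_NoneP xP; apply/lam_SomeP.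
suff xq (q : rat) : 0 < q -> `|(x : L)^-1| <= ratr q.
  move=> q; rewrite ltrq0 ltr0q; split=> q0; last first.
    by apply: le_trans (ler_norm _) (xq _ q0).
  have := xq (- q); rewrite oppr_gt0 rmorphN => /(_ q0).
  by rewrite ler_norml opprK => /andP[].
move=> q0; rewrite normfV; apply: (@le_trans _ L (ratr q^-1)^-1); last first.
  by rewrite fmorphV invrK.
rewrite lef_pV2 ?posrE ?normr_gt0 ?ltr0q ?invr_gt0 //.
have := archi_boundP (ltW (_ : 0 < q^-1)); rewrite invr_gt0 => /(_ q0) qb.
by apply: ltW; apply: lt_trans (xP (Num.bound q^-1)); rewrite -(ratr_nat L) ltr_rat.
Qed.

Lemma lam_place : is_Rplace (lam P).
Proof.
split; first exact: lam1; split; last exact: lamV.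
by move=> x y r s xr ys; rewrite (lamD xr ys) (lamM xr ys).
Qed.

End OrderedField.

(* [g] is a positive unit of the valuation ring of [lam P]. *)
Definition unit_pos (K : fieldType) (P : set K) (g : K) :=
  exists n : nat, P (g - n.+1%:R^-1) /\ P (n.+1%:R - g).

(** Translates the subbasis of the topology into the ordering alone: a positive real number lies
    strictly between two positive rationals. *)
Lemma Hp_lam (K : fieldType) (P : set K) (g : K) : is_ordering P ->
  Hp g (lam P) <-> unit_pos P g.
Proof.
move=> HP; split.
  move=> [r [/(lam_SomeP HP) gr r0]].
  have [q1 [q10 q1r]] := rat_between r0.
  have [q2 [rq2 _]] := rat_between (ltac:(lra) : r < r + 1).
  rewrite ltr0q in q10; have q20 : 0 < q2 by rewrite -(ltr0q RR); lra.
  have q1V : 0 < q1^-1 by rewrite invr_gt0.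
  exists (maxn (Num.bound q1^-1) (Num.bound q2)); set n := maxn _ _.
  have n1 : q1^-1 <= n.+1%:R.
    apply: ltW; apply: lt_le_trans (archi_boundP (ltW q1V)) _.
    by rewrite ler_nat leqW // leq_maxl.
  have n2 : q2 <= n.+1%:R.
    apply: ltW; apply: lt_le_trans (archi_boundP (ltW q20)) _.
    by rewrite ler_nat leqW // leq_maxr.
  split.
    apply/(ofield_natV_le HP); apply: le_trans ((gr q1).1 q1r).
    by rewrite ler_rat -[q1]invrK lef_pV2 ?posrE ?ltr0n.
  apply/(ofield_le_nat HP); apply: le_trans ((gr q2).2 rq2) _.
  by rewrite -(ratr_nat (ofield HP)) ler_rat.
move=> [n [/(ofield_natV_le HP) ng /(ofield_le_nat HP) gn]].
have g0 : 0 <= (g : ofield HP).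
  by apply: le_trans ng; rewrite ler0q invr_ge0 ler0n.
have [/(lam_NoneP HP)/(_ n.+1)|[r gr]] := lam_NoneVSome P g.
  by rewrite ger0_norm // ltNge gn.
exists r; split=> //; have n0' : 0 < (n.+1%:R^-1 : RR) by rewrite invr_gt0 ltr0n.
apply: lt_le_trans n0' _; rewrite leNgt; apply/negP => rn.
have [q [rq qn]] := rat_between rn.
have := le_trans ng (((lam_SomeP HP g r).1 gr q).2 rq).
by rewrite ler_rat leNgt -(ltr_rat RR) fmorphV rmorph_nat qn.
Qed.

(** * Orderings inducing a given place *)

Section RealPlace.
Variables (K : fieldType) (z : K -> option RR) (zP : is_Rplace z).

Lemma place1 : z 1 = Some 1. Proof. exact: zP.1. Qed.

Lemma placeD x y r s : z x = Some r -> z y = Some s -> z (x + y) = Some (r + s).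
Proof. by move=> zx zy; case: (zP.2.1 _ _ _ _ zx zy). Qed.

Lemma placeM x y r s : z x = Some r -> z y = Some s -> z (x * y) = Some (r * s).
Proof. by move=> zx zy; case: (zP.2.1 _ _ _ _ zx zy). Qed.

Lemma placeV0 x : x != 0 -> z x = None -> z x^-1 = Some 0.
Proof. exact: zP.2.2. Qed.

(** The axioms of a place do not mention negatives. As -1 is its own inverse its value is finite and
    squares to 1; the value 1 would give 0 = 1 + (-1) the value 2, and then 0 + 0 the value 4. *)
Lemma placeN1 : z (-1) = Some (-1).
Proof.
have N10 : -1 != 0 :> K by rewrite oppr_eq0 oner_neq0.
case E : (z (-1)) => [s|]; last first.
  by have := placeV0 N10 E; rewrite invrN1 E.
have := placeM E E; rewrite mulrNN mulr1 place1 => -[] s2.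
have [->//|s1] := eqVneq s (-1).
have s1' : s = 1.
  apply/eqP; rewrite -subr_eq0.
  have /eqP : (s - 1) * (s + 1) = 0 by rewrite -subr_sqr expr2 -s2 expr1n subrr.
  by rewrite mulf_eq0 [s + 1 == 0]addr_eq0 (negPf s1) orbF.
move: E; rewrite s1' => E.
have E2 := placeD place1 E; rewrite subrr in E2.
by exfalso; have := placeD E2 E2; rewrite addr0 E2 => -[]; lra.
Qed.

Lemma placeN x r : z x = Some r -> z (- x) = Some (- r).
Proof. by move=> zx; rewrite -mulN1r (placeM placeN1 zx) mulN1r. Qed.

Lemma placeB x y r s : z x = Some r -> z y = Some s -> z (x - y) = Some (r - s).
Proof. by move=> zx /placeN; apply: placeD. Qed.

Lemma place0 : z 0 = Some 0.
Proof. by have := placeB place1 place1; rewrite !subrr. Qed.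

Lemma place_nat n : z n%:R = Some n%:R.
Proof.
elim: n => [|n IH]; first exact: place0.
by rewrite -!natr1; apply: placeD IH place1.
Qed.

Lemma place_int m : z m%:~R = Some m%:~R.
Proof.
case: m => n; first exact: place_nat.
by rewrite NegzE !mulrNz; apply/placeN/place_nat.
Qed.

Lemma placeV x r : z x = Some r -> r != 0 -> z x^-1 = Some r^-1.
Proof.
move=> zx r0; have x0 : x != 0.
  by apply: contraNneq r0 => x0; move: zx; rewrite x0 place0 => -[<-].
case E : (z x^-1) => [s|].
  have := placeM zx E; rewrite divff // place1 => -[] /esym/mulr1_eq ->.
  by [].
have := placeV0 (_ : x^-1 != 0) E; rewrite invr_eq0 invrK zx => /(_ x0)[] r00.
by rewrite r00 eqxx in r0.
Qed.

Lemma place_rat q : z (ratr q) = Some (ratr q).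
Proof.
apply: placeM; first exact: place_int.
by apply: placeV; [exact: place_int|rewrite intr_eq0 denq_eq0].
Qed.

Lemma Hp_divr x y : x != 0 -> y != 0 ->
  (exists r, z (y / x) = Some r) \/ (exists r, z (x / y) = Some r).
Proof.
move=> x0 y0; case E : (z (y / x)) => [r|]; first by left; exists r.
right; exists 0; rewrite -invf_div; apply: placeV0 E.
by rewrite mulf_neq0 // invr_eq0.
Qed.

(* Every ordering compatible with [z] contains this set, and any ordering that
   contains it induces [z] (Baer-Krull). *)
Definition pre_cone : set K := [set g | exists x u, g = x ^+ 2 * u /\ Hp u z].

Lemma Hp1 : Hp 1 z.
Proof. by exists 1; rewrite place1 ltr01. Qed.

Lemma pre_cone_sqr x : pre_cone (x ^+ 2).
Proof. by exists x, 1; rewrite mulr1; split=> //; exact: Hp1. Qed.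

Lemma pre_cone_Hp u : Hp u z -> pre_cone u.
Proof. by move=> uP; exists 1, u; rewrite expr1n mul1r. Qed.

Lemma pre_coneM g h : pre_cone g -> pre_cone h -> pre_cone (g * h).
Proof.
move=> [x [u [-> [r [ur r0]]]]] [y [w [-> [s [ws s0]]]]].
exists (x * y), (u * w); split; first by ring.
by exists (r * s); rewrite (placeM ur ws) mulr_gt0.
Qed.

(** Of y/x and x/y at least one is finite. Pulling out the square of the dominating term leaves u +
    t^2 w with finite t, whose value is still positive. *)
Lemma pre_coneD g h : pre_cone g -> pre_cone h -> pre_cone (g + h).
Proof.
move=> [x [u [-> [r [ur r0]]]]] [y [w [-> [s [ws s0]]]]].
have [->|x0] := eqVneq x 0.
  by exists y, w; split; [ring|exists s].
have [->|y0] := eqVneq y 0.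
  by exists x, u; split; [ring|exists r].
have key (a b c : RR) : 0 < a -> 0 < b -> 0 < a + c * c * b.
  move=> a0 b0; rewrite ltr_pwDl //.
  by rewrite mulr_ge0 ?(ltW b0) // -expr2 sqr_ge0.
have [[t tP]|[t tP]] := Hp_divr x0 y0.
  exists x, (u + (y / x) * (y / x) * w); split; first by field.
  exists (r + t * t * s); split; last exact: key.
  exact: (placeD ur (placeM (placeM tP tP) ws)).
exists y, (w + (x / y) * (x / y) * u); split; first by field.
exists (s + t * t * r); split; last exact: key.
exact: (placeD ws (placeM (placeM tP tP) ur)).
Qed.

(** If -1 = x^2 u, then u = -(1/x)^2 has value <= 0 when 1/x is finite; otherwise x has value 0 and
    so has x^2 u. *)
Lemma pre_coneN1 : ~ pre_cone (-1).
Proof.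
move=> [x [u [E [r [ur r0]]]]].
have x0 : x != 0.
  apply/eqP => x0; move/eqP: E.
  by rewrite x0 expr0n mul0r oppr_eq0 oner_eq0.
have uE : u = - (x^-1 * x^-1) by rewrite -[u](mulKf (expf_neq0 2 x0)) -E; field.
case xr : (z x^-1) => [s|].
  move: ur; rewrite uE (placeN (placeM xr xr)) => -[] rE.
  by move: r0; rewrite -rE oppr_gt0 ltNge -expr2 sqr_ge0.
have := placeV0 (_ : x^-1 != 0) xr; rewrite invr_eq0 invrK => /(_ x0) zx.
have := placeM (placeM zx zx) ur; rewrite -expr2 -E placeN1 => -[] /eqP.
by rewrite !mul0r oppr_eq0 oner_eq0.
Qed.

End RealPlace.

(** Testing x - q and q - x for rational q transfers finite values from z1 to z2. An x infinite for
    z1 has an inverse of value 0, also for z2, so one implication is enough. *)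
Lemma place_ext (K : fieldType) (z1 z2 : K -> option RR) :
  is_Rplace z1 -> is_Rplace z2 -> (forall g, Hp g z1 -> Hp g z2) -> z1 = z2.
Proof.
move=> z1P z2P H.
have S x r : z1 x = Some r -> z2 x = Some r.
  move=> xr; have lt q : ratr q < r -> exists2 t, z2 x = Some t & ratr q < t.
    move=> qr; have [|s [sE s0]] := H (x - ratr q).
      exists (r - ratr q); rewrite subr_gt0; split=> //.
      exact: placeB xr (place_rat z1P q).
    exists (s + ratr q); last by rewrite ltrDr.
    by rewrite -[x in LHS](subrK (ratr q)); apply: placeD sE (place_rat z2P q).
  have gt q : r < ratr q -> exists2 t, z2 x = Some t & t < ratr q.
    move=> rq; have [|s [sE s0]] := H (ratr q - x).
      exists (ratr q - r); rewrite subr_gt0; split=> //.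
      exact: placeB (place_rat z1P q) xr.
    exists (ratr q - s); last by rewrite gtrDl oppr_lt0.
    by rewrite -[x in LHS](subKr (ratr q)); apply: placeB (place_rat z2P q) sE.
  have [q [_ /lt[t tE _]]] := rat_between (ltac:(lra) : r - 1 < r).
  rewrite tE; congr Some; apply: le_anti; rewrite !leNgt; apply/andP; split; apply/negP.
    move=> /rat_between[q' [rq qt]]; have [t' + t'q] := gt _ rq.
    by rewrite tE => -[tt]; move: t'q; rewrite -tt ltNge (ltW qt).
  move=> /rat_between[q' [tq qr]]; have [t' + t'q] := lt _ qr.
  by rewrite tE => -[tt]; move: t'q; rewrite -tt ltNge (ltW tq).
apply/funext => x; case E : (z1 x) => [r|]; first by rewrite (S _ _ E).
have x0 : x != 0.
  by apply/eqP => x0; move: E; rewrite x0 (place0 z1P).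
case E2 : (z2 x) => [s|//].
have := placeM z2P E2 (S _ _ (placeV0 z1P x0 E)).
by rewrite divff // (place1 z2P) mulr0 => -[] /eqP; rewrite oner_eq0.
Qed.

Definition preordering (K : fieldType) (T : set K) :=
  [/\ forall a b, T a -> T b -> T (a + b), forall a b, T a -> T b -> T (a * b),
      forall a, T (a ^+ 2) & ~ T (-1)].

(** Artin's argument: Zorn's lemma gives a maximal preordering, and maximality makes it total. *)
Lemma preordering_extend (K : fieldType) (T : set K) : preordering T ->
  exists P, T `<=` P /\ is_ordering P.
Proof.
move=> [TD TM T2 TN1].
(* [set0] is allowed because [Zorn_bigcup] also takes the union of the empty chain. *)
pose good (Q : set K) := Q = set0 \/ (preordering Q /\ T `<=` Q).
have [A [goodA maxA]] : exists A, good A /\ forall B, A `<` B -> ~ good B.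
  apply: Zorn_bigcup => F FP Ftot.
  have [[Q0 FQ0 Q00]|nF] := pselect (exists2 Q, F Q & Q <> set0); last first.
    left; apply/seteqP; split=> // x [Q FQ Qx].
    by apply: nF; exists Q => // QE; rewrite QE in Qx.
  have FG Q x : F Q -> Q x -> preordering Q /\ T `<=` Q.
    by move=> FQ Qx; have [QE|//] := FP _ FQ; rewrite QE in Qx.
  have [//|[[Q0D Q0M Q02 Q0N] TQ0]] := FP _ FQ0.
  right; split; last by move=> x /TQ0 Qx; exists Q0.
  have comm a b : (\bigcup_(X in F) X) a -> (\bigcup_(X in F) X) b ->
      exists Q, [/\ F Q, Q a & Q b].
    move=> [Q1 FQ1 Q1a] [Q2 FQ2 Q2b].
    by have [s|s] := Ftot _ _ FQ1 FQ2; [exists Q2|exists Q1]; split=> //; apply: s.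
  split=> [a b Ua Ub|a b Ua Ub|a|[Q FQ QN]].
  - have [Q [FQ Qa Qb]] := comm _ _ Ua Ub; exists Q => //.
    by have [[QD _ _ _] _] := FG _ _ FQ Qa; apply: QD.
  - have [Q [FQ Qa Qb]] := comm _ _ Ua Ub; exists Q => //.
    by have [[_ QM _ _] _] := FG _ _ FQ Qa; apply: QM.
  - by exists Q0.
  - by have [[_ _ _]] := FG _ _ FQ QN.
have [[AD AM A2 AN1] TA] : preordering A /\ T `<=` A.
  case: goodA => // A0; have [] := maxA T; last by right; split=> //; split.
  rewrite A0; split=> // T0; have := T0 _ (T2 0); exact.
exists A; split=> //; split=> //; split=> //; split=> [x|x Ax ANx]; last first.
  apply/eqP; apply: contrapT => /negP x0; apply: AN1.
  have -> : -1 = x * - x * (x^-1) ^+ 2 by field.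
  by apply: (AM) => //; apply: (AM).
have [Ax|nAx] := pselect (A x); [by left|right].
(* The semiring generated by A and -x. If it contained -1 = a - b x, then x = (a + 1)/b would lie in
   A. *)
pose B := [set g | exists a b, [/\ A a, A b & g = a - b * x]].
apply: contrapT => nANx.
have A0 : A 0 by rewrite -[0](expr0n _ 2); exact: A2.
have A1 : A 1 by rewrite -[1](expr1n _ 2); exact: A2.
have AB : A `<=` B by move=> a Aa; exists a, 0; split=> //; rewrite mul0r subr0.
apply: (maxA B).
  split=> // BA; apply: nANx; apply: BA; exists 0, 1; split=> //; ring.
right; split; last exact: subset_trans TA AB.
split=> [_ _ [a [b [Aa Ab ->]]] [c [d [Ac Ad ->]]]|||].
- by exists (a + c), (b + d); split; [exact: AD|exact: AD|ring].
- move=> _ _ [a [b [Aa Ab ->]]] [c [d [Ac Ad ->]]].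
  exists (a * c + b * d * x ^+ 2), (a * d + b * c); split; last by ring.
    by apply: (AD); apply: (AM) => //; apply: (AM).
  by apply: (AD); apply: (AM).
- by move=> a; exists (a ^+ 2), 0; split=> //; ring.
move=> [a [b [Aa Ab E]]]; have [b0|b0] := eqVneq b 0.
  by apply: AN1; rewrite E b0 mul0r subr0.
apply: nAx; have -> : x = (a + 1) * b * (b^-1) ^+ 2.
  have -> : a + 1 = b * x by rewrite -[b * x](subKr a) -E; ring.
  by field.
by apply: (AM) => //; apply: (AM) => //; exact: AD.
Qed.

Lemma Hp_archi (K : fieldType) (z : K -> option RR) g : is_Rplace z -> Hp g z ->
  exists n, Hp (g - n.+1%:R^-1) z /\ Hp (n.+1%:R - g) z.
Proof.
move=> zP [r [gr r0]]; have rV0 : 0 < r^-1 by rewrite invr_gt0.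
exists (maxn (Num.bound r^-1) (Num.bound r)); set n := maxn _ _.
have n1 : r^-1 < n.+1%:R.
  apply: lt_le_trans (archi_boundP (ltW rV0)) _.
  by rewrite ler_nat leqW // leq_maxl.
have n2 : r < n.+1%:R.
  apply: lt_le_trans (archi_boundP (ltW r0)) _.
  by rewrite ler_nat leqW // leq_maxr.
have n0 : n.+1%:R != 0 :> RR by rewrite pnatr_eq0.
split.
  exists (r - n.+1%:R^-1); split.
    exact: placeB gr (placeV zP (place_nat zP _) n0).
  by rewrite subr_gt0 -[r]invrK ltf_pV2 ?posrE ?ltr0n.
by exists (n.+1%:R - r); rewrite subr_gt0; split=> //; exact: placeB (place_nat zP _) gr.
Qed.

(** Inclusion of the positive units of z in P suffices: for such a g, the elements g - 1/(n+1) and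
    (n+1) - g are positive units for a large n, which bounds g with respect to P. *)
Lemma place_eq_lam (K : fieldType) (z : K -> option RR) P : is_Rplace z ->
  is_ordering P -> (forall g, Hp g z -> P g) -> z = lam P.
Proof.
move=> zP HP H; apply: place_ext => //; first exact: lam_place.
by move=> g /(Hp_archi zP)[n [n1 n2]]; apply/Hp_lam => //; exists n; split; exact: H.
Qed.

Lemma place_ordering (K : fieldType) (z : K -> option RR) : is_Rplace z ->
  exists P, is_ordering P /\ lam P = z.
Proof.
move=> zP; have [|P [TP HP]] := @preordering_extend K (pre_cone z).
  split; [exact: pre_coneD|exact: pre_coneM|exact: pre_cone_sqr|exact: pre_coneN1].
exists P; split=> //; apply/esym/place_eq_lam => // g gz.
exact/TP/pre_cone_Hp.
Qed.

(** * Orderings of K(y) and cuts of K *)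

(** A root a + bi exists over the algebraically closed K[i], with b nonzero. The remainder of p
    modulo (X - a)^2 + b^2 is linear over K and vanishes at a + bi, hence is 0. *)
Lemma rcf_poly_quadratic_factor (K : rcfType) (p : {poly K}) :
  (1 < size p)%N -> (forall x, ~~ root p x) ->
  exists a b, b != 0 /\ (('X - a%:P) ^+ 2 + (b ^+ 2)%:P) %| p.
Proof.
move=> sp nr; pose toC := (real_complex K : {rmorphism K -> K[i]}).
have /closed_rootP[[a b] /rootP pz] : size (map_poly toC p) != 1.
  by rewrite size_map_poly; apply: contraTneq sp => ->.
have zE : Complex a b = toC a + toC b * Complex 0 1 by simpc.
have b0 : b != 0.
  apply: contraNneq (nr a) => b0; apply/rootP/(fmorph_inj toC).
  by rewrite -horner_map rmorph0 -[RHS]pz zE b0 rmorph0 mul0r addr0.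
exists a, b; split=> //; set d := _ + _.
have dz : (map_poly toC d).[Complex a b] = 0.
  rewrite rmorphD rmorphXn rmorphB /= map_polyX !map_polyC /= !hornerE zE.
  by simpc; congr Complex; ring.
have sd : size d = 3%N.
  rewrite /d size_polyDl; first by rewrite size_exp_XsubC.
  by rewrite size_exp_XsubC (leq_ltn_trans (size_polyC_leq1 _)).
set r := p %% d; have r2 : (size r <= 2)%N.
  by rewrite -ltnS -sd ltn_modp -size_poly_eq0 sd.
have rE : (r : {poly K}) = (r`_0)%:P + r`_1 *: 'X.
  apply/polyP => -[|[|i]]; rewrite coefD coefC coefZ coefX /= ?mulr0 ?mulr1 ?addr0 ?add0r //.
  by rewrite nth_default // (leq_trans r2).
have rz : (map_poly toC r).[Complex a b] = 0.
  by rewrite -[RHS]pz [in RHS](divp_eq p d) rmorphD rmorphM hornerD hornerM dz mulr0 add0r.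
move: rE; move: r`_0 r`_1 => r0 r1 rE.
move: rz; rewrite rE rmorphD /= map_polyC map_polyZ map_polyX !hornerE /=.
simpc => -[] /eqP r0E /eqP; rewrite mulf_eq0 (negPf b0) orbF => /eqP r10.
by rewrite /dvdp -/r rE; move: r0E; rewrite r10 mul0r addr0 => /eqP ->; rewrite scale0r addr0.
Qed.

Section Uniqueness.
Variables (K : rcfType) (C : cut K) (P : set (ratfun K)).
Hypotheses (HP : is_ordering P)
  (PC : lower C = [set d | P (ratvar K - ratconst d)]).

Lemma ordering_sqr (L : fieldType) (Q : set L) (x : L) :
  is_ordering Q -> Q (x ^+ 2).
Proof.
move=> [_ [QM [QT _]]]; have [Qx|Qx] := QT x; first exact: QM.
by rewrite -sqrrN; exact: QM.
Qed.

Lemma ordering_const (c : K) : 0 <= c -> P (ratconst c).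
Proof.
move=> c0; have -> : ratconst c = ratconst (Num.sqrt c) ^+ 2.
  by rewrite /ratconst /polyfrac -tofracXn -polyC_exp sqr_sqrtr.
exact: ordering_sqr.
Qed.

(* A polynomial over a real closed field is a product of linear factors, whose
   sign is decided by the cut, and of sums of two squares. *)
Lemma ordering_poly (p : {poly K}) :
  near C (fun x => 0 <= p.[x]) -> P (polyfrac p).
Proof.
have P0 : P 0 by have := ordering_sqr 0 HP; rewrite expr0n.
have [n sp] := ubnP (size p); elim: n p sp => // n IH p sp pC.
have [->|p0] := eqVneq p 0; first by rewrite /polyfrac tofrac0.
have [[a pa]|nr] := pselect (exists a, root p a); last first.
  have [/size1_polyC pE|sp1] := leqP (size p) 1.
    rewrite pE; apply: ordering_const.
    have [x] := near_ex pC; rewrite {1}pE hornerC.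
    exact.
  have [|a [b [b0 /dvdpP[q pE]]]] := rcf_poly_quadratic_factor sp1.
    by move=> x; apply/negP => px; apply: nr; exists x.
  have q0 : q != 0 by apply: contraNneq p0 => q0; rewrite pE q0 mul0r.
  have dx x : 0 < (('X - a%:P) ^+ 2 + (b ^+ 2)%:P).[x].
    by rewrite !hornerE ltr_wpDl ?sqr_ge0 // lt_def sqr_ge0 sqrf_eq0 b0.
  rewrite pE /polyfrac tofracM; apply: (HP.2.1).
    apply: IH; last first.
      by apply: near1 pC => x; rewrite pE hornerM pmulr_lge0.
    rewrite -ltnS; apply: leq_trans sp; rewrite pE size_mul //; last first.
      by apply/eqP => d0; have := dx 0; rewrite d0 horner0 ltxx.
    rewrite size_polyDl ?size_exp_XsubC ?addn3 //=.
    by rewrite (leq_ltn_trans (size_polyC_leq1 _)).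
  rewrite tofracD tofracXn -[tofrac (b ^+ 2)%:P]/(ratconst (b ^+ 2)).
  apply: (HP.1); first exact: ordering_sqr.
  by apply: ordering_const; rewrite sqr_ge0.
have /factor_theorem[q pE] := pa.
have q0 : q != 0 by apply: contraNneq p0 => q0; rewrite pE q0 mul0r.
have sq : (size q < n)%N.
  rewrite -ltnS; apply: leq_trans sp; rewrite pE size_mul ?polyXsubC_eq0 //.
  by rewrite size_XsubC addn2.
have XaE : polyfrac ('X - a%:P) = ratvar K - ratconst a by rewrite /polyfrac tofracB.
have [Ca|Ca] := pselect (lower C a).
  have PXa : P (polyfrac ('X - a%:P)) by rewrite XaE; move: Ca; rewrite PC.
  rewrite pE /polyfrac tofracM; apply: (HP.2.1) => //; apply: IH => //.
  apply: near1 (nearI pC (near_lower Ca)) => x; rewrite pE hornerM !hornerE => -[+ ax].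
  by rewrite pmulr_lge0 // subr_gt0.
have PXa : P (- polyfrac ('X - a%:P)).
  have [|//] := HP.2.2.1 (polyfrac ('X - a%:P)).
  by rewrite XaE => Pa; case: Ca; rewrite PC.
rewrite pE -mulrNN /polyfrac tofracM !tofracN; apply: (HP.2.1) => //.
rewrite -tofracN; apply: IH; first by rewrite size_polyN.
apply: near1 (nearI pC (near_upper Ca)) => x; rewrite pE hornerM !hornerE => -[+ ax].
by rewrite nmulr_lge0 ?subr_lt0 // oppr_ge0.
Qed.

(** Only [pos C] included in P has to be shown, since two comparable orderings coincide; multiplying
    p/q by q^2 reduces this to polynomials. *)
Lemma ordering_unique : P = pos C.
Proof.
have sub : pos C `<=` P.
  elim/ratfun_ind => p q q0 pqC.
  have qf0 : polyfrac q != 0 :> ratfun K by rewrite tofrac_eq0.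
  have -> : polyfrac p / polyfrac q = polyfrac (p * q) * ((polyfrac q)^-1) ^+ 2.
    by rewrite /polyfrac tofracM expr2 mulrA mulfK.
  apply: (HP.2.1); last exact: ordering_sqr.
  apply: ordering_poly.
  apply: near1 (nearI pqC (eval_frac C p q0)) => x [+ [qx E]]; rewrite E => pq.
  have -> : (p * q).[x] = p.[x] / q.[x] * (q.[x]) ^+ 2 by rewrite hornerM; field.
  by rewrite mulr_ge0 // sqr_ge0.
apply/seteqP; split=> // g Pg.
have [_ [_ [T _]]] := pos_ordering C; have [//|Ng] := T g.
have -> : g = 0 by apply: (HP.2.2.2) => //; exact: sub.
by have := ordering_sqr 0 (pos_ordering C); rewrite expr0n.
Qed.

End Uniqueness.

Lemma chiE (K : rcfType) (C : cut K) : chi C = pos C.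
Proof.
have [] := epsilon_spec (inhabits set0) (fun P : set (ratfun K) =>
    is_ordering P /\ lower C = [set d | P (ratvar K - ratconst d)]).
  by exists (pos C); split; [exact: pos_ordering|exact: lower_pos].
exact: ordering_unique.
Qed.

Definition cut_place (K : rcfType) (C : cut K) := lam (pos C).

Lemma cut_placeP (K : rcfType) (C : cut K) : is_Rplace (cut_place C).
Proof. exact/lam_place/pos_ordering. Qed.

(** An ordering inducing the place exists by Baer-Krull; its signs on the elements y - d form a cut,
    and the cut determines the ordering. *)
Lemma place_cut (K : rcfType) z : is_Rplace z ->
  exists C : cut K, z = cut_place C.
Proof.
move=> /place_ordering[P [HP <-]].
have Di : is_initial [set d | P (ratvar K - ratconst d)].
  move=> x y xy /= Py.
  have -> : ratvar K - ratconst x = (ratvar K - ratconst y) + ratconst (y - x).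
    by rewrite /ratconst /polyfrac polyCB tofracB addrA subrK.
  by apply: (HP.1) => //; apply: ordering_const => //; rewrite subr_ge0.
by exists (exist _ _ Di); rewrite /cut_place -(@ordering_unique _ _ P).
Qed.

(** * Cuts and the interval topology *)

Section Units.
Variable K : rcfType.
Implicit Types (C : cut K) (g : ratfun K).

Lemma ratconst_nat n : n%:R = ratconst n%:R :> ratfun K.
Proof. by rewrite /ratconst /polyfrac !rmorph_nat. Qed.

Lemma ratconst_natV n : n.+1%:R^-1 = ratconst n.+1%:R^-1 :> ratfun K.
Proof.
apply: mulr1_eq; rewrite ratconst_nat /ratconst /polyfrac -tofracM -polyCM.
by rewrite divff ?pnatr_eq0 // polyC1 tofrac1.
Qed.

Lemma unit_posP C g : unit_pos (pos C) g <-> exists n : nat,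
  near C (fun x => n.+1%:R^-1 <= ratfun_eval g x <= n.+1%:R).
Proof.
split=> -[n].
  move=> [g1 g2]; exists n; move: g1 g2; rewrite ratconst_nat => g1 g2.
  rewrite -ratconst_nat ratconst_natV in g1.
  have := nearI (nearI g1 (nearI (evalB C g (ratconst n.+1%:R^-1)) (evalC C n.+1%:R^-1)))
    (nearI g2 (nearI (evalB C (ratconst n.+1%:R) g) (evalC C n.+1%:R))).
  apply: near1 => x [[+ [E1 E2]] [+ [E3 E4]]].
  by rewrite E1 E2 E3 E4 !subr_ge0 => -> ->.
move=> g12; exists n; rewrite ratconst_natV; split.
  have := nearI g12 (nearI (evalB C g (ratconst n.+1%:R^-1)) (evalC C n.+1%:R^-1)).
  by apply: near1 => x [/andP[g1 g2] [-> ->]]; rewrite subr_ge0.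
rewrite ratconst_nat.
have := nearI g12 (nearI (evalB C (ratconst n.+1%:R) g) (evalC C n.+1%:R)).
by apply: near1 => x [/andP[g1 g2] [-> ->]]; rewrite subr_ge0.
Qed.

Lemma Hp_cut_place C g : Hp g (cut_place C) <-> unit_pos (pos C) g.
Proof. exact/Hp_lam/pos_ordering. Qed.

Lemma unit_pos_half_one C g : near C (fun x => 2^-1 <= ratfun_eval g x <= 1) ->
  unit_pos (pos C) g.
Proof.
move=> gC; apply/unit_posP; exists 1; apply: near1 gC => x /andP[g1 g2].
by rewrite g1 /=; lra.
Qed.

Lemma unit_pos_gt0 C g : unit_pos (pos C) g ->
  near C (fun x => 0 < ratfun_eval g x).
Proof.
move=> /unit_posP[n]; apply: near1 => x /andP[g1 _].
by apply: lt_le_trans g1; rewrite invr_gt0 ltr0n.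
Qed.

(** Agreement with C on finite sets gives a neighbourhood base of C in the interval topology
    ([interval_openP]); this form combines directly with [near]. *)
Definition agree (s : seq K) C C' := forall a, a \in s -> lower C a <-> lower C' a.

Lemma near_agree C (Q : K -> Prop) : near C Q ->
  exists s, forall C', agree s C C' -> near C' Q.
Proof.
move=> [s sQ]; exists s => C' CC'; exists s => x sx; apply: sQ => a sa.
by have [h1 h2] := sx a sa; rewrite (CC' a sa).
Qed.

Lemma agree_cat s1 s2 C C' : agree (s1 ++ s2) C C' <-> agree s1 C C' /\ agree s2 C C'.
Proof.
split=> [h|[h1 h2] a]; first by split=> a sa; apply: h; rewrite mem_cat sa ?orbT.
by rewrite mem_cat => /orP[/h1|/h2].
Qed.

Lemma unit_pos_agree C g : unit_pos (pos C) g ->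
  exists s, forall C', agree s C C' -> unit_pos (pos C') g.
Proof.
move=> /unit_posP[n /near_agree[s sP]]; exists s => C' /sP ?.
by apply/unit_posP; exists n.
Qed.

Lemma cut_eq C C' : lower C = lower C' -> C = C'.
Proof. by case: C C' => D i [D' i'] /= DD'; apply: eq_exist. Qed.

Lemma cut_ext C C' : (forall x, lower C x <-> lower C' x) -> C = C'.
Proof. by move=> CC'; apply/cut_eq/funext => x; apply/propext. Qed.

Lemma mem_lower_uniq C C' : (forall x, lower C x -> lower C' x) ->
  (forall x, ~ lower C x -> ~ lower C' x) -> C = C'.
Proof.
move=> h1 h2; apply: cut_ext => x; split; first exact: h1.
by move=> C'x; apply: contrapT => /h2.
Qed.

Lemma lower_total C C' :
  (forall x, lower C x -> lower C' x) \/ (forall x, lower C' x -> lower C x).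
Proof.
have [|n] := pselect (forall x, lower C x -> lower C' x); [by left|right].
move=> x C'x; apply: contrapT => Cx; apply: n => y Cy.
exact: lower_le (ltW (lower_lt Cy Cx)) C'x.
Qed.

Lemma lower_neq C C' : C <> C' -> (forall x, lower C x -> lower C' x) ->
  exists x, ~ lower C x /\ lower C' x.
Proof.
move=> n sub; apply: contrapT => h; apply: n; apply: mem_lower_uniq => // x Cx C'x.
by apply: h; exists x.
Qed.

Fact below_initial (a : K) : is_initial [set x | x < a].
Proof. by move=> x y; exact: le_lt_trans. Qed.
Definition below (a : K) : cut K := exist _ _ (@below_initial a).

Fact upto_initial (a : K) : is_initial [set x | x <= a].
Proof. by move=> x y; exact: le_trans. Qed.
Definition upto (a : K) : cut K := exist _ _ (@upto_initial a).

(** Nothing is claimed about l when no element of s lies below the cut, nor about u when none lies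
    above, so users must check on which side l and u lie. *)
Lemma seq_lower_bounds (s : seq K) C : exists l u,
  (forall a, a \in s -> lower C a -> lower C l /\ a <= l) /\
  (forall a, a \in s -> ~ lower C a -> ~ lower C u /\ u <= a).
Proof.
elim: s => [|a s [l [u [lP uP]]]]; first by exists 0, 0.
have [Ca|Ca] := pselect (lower C a).
  have [Cl|Cl] := pselect (lower C l).
    exists (Num.max l a), u; split=> b; rewrite inE => /orP[/eqP ->|bs] Cb.
    - by rewrite le_max lexx orbT; split=> //; case: (leP l a).
    - by have [_ bl] := lP _ bs Cb; rewrite le_max bl; split=> //; case: (leP l a).
    - by [].
    - exact: uP.
  exists a, u; split=> b; rewrite inE => /orP[/eqP ->|bs] Cb //; last exact: uP.
  by have [/Cl] := lP _ bs Cb.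
have [Cu|Cu] := pselect (lower C u).
  exists l, a; split=> b; rewrite inE => /orP[/eqP ->|bs] Cb //; first exact: lP.
  by have [/(_ Cu)] := uP _ bs Cb.
exists l, (Num.min u a); split=> b; rewrite inE => /orP[/eqP ->|bs] Cb //.
- exact: lP.
- by rewrite ge_min lexx orbT; split=> //; case: (leP u a).
- by have [_ bl] := uP _ bs Cb; rewrite ge_min bl; split=> //; case: (leP u a).
Qed.

Lemma interval_openP (U : set (cut K)) : interval_open U <->
  forall C, U C -> exists s, forall C', agree s C C' -> U C'.
Proof.
have ltP C1 C2 : cut_lt C1 C2 <-> exists x, ~ lower C1 x /\ lower C2 x.
  split=> [[sub n]|[x [C1x C2x]]].
    by apply: lower_neq sub => E; apply: n; rewrite E.
  split=> [y C1y|E]; last by rewrite E in C1x.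
  exact: lower_le (ltW (lower_lt C1y C1x)) C2x.
split=> H C UC.
  have [B [bB [BC BU]]] := H _ UC.
  case: bB BC BU => [[C1 [C2 ->]]|[[C1 ->]|[C2 ->]]] /=.
  - move=> [/ltP[x [x1 x2]] /ltP[y [y1 y2]]] BU; exists [:: x; y] => C' CC'.
    apply: BU; split; apply/ltP; [exists x|exists y].
      by rewrite -(CC' x) ?inE ?eqxx.
    by rewrite -(CC' y) ?inE ?eqxx ?orbT.
  - move=> /ltP[x [x1 x2]] BU; exists [:: x] => C' CC'.
    by apply: BU; apply/ltP; exists x; rewrite -(CC' x) ?inE ?eqxx.
  - move=> /ltP[x [x1 x2]] BU; exists [:: x] => C' CC'.
    by apply: BU; apply/ltP; exists x; rewrite -(CC' x) ?inE ?eqxx.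
have [s sU] := H _ UC; have [l [u [lP uP]]] := seq_lower_bounds s C.
have [Cl|Cl] := pselect (lower C l); have [Cu|Cu] := pselect (lower C u).
- exists [set C' | cut_lt (below l) C']; split; first by right; left; eexists.
  split=> [|C' /= /ltP[x [/= xl C'x]]]; first by apply/ltP; exists l; rewrite /= ltxx.
  apply: sU => a sa; split=> [Ca|C'a].
    have [_ al] := lP _ sa Ca; apply: lower_le C'x; apply: le_trans al _.
    by rewrite leNgt; apply/negP.
  by apply: contrapT => /(uP _ sa)[/(_ Cu)].
- exists [set C' | cut_lt (below l) C' /\ cut_lt C' (upto u)].
  split; first by left; do 2!eexists.
  split=> [|C' [/= /ltP[x [/= xl C'x]] /ltP[y [C'y /= yu]]]].
    by split; apply/ltP; [exists l|exists u]; rewrite /= ?ltxx.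
  apply: sU => a sa; split=> [Ca|C'a].
    have [_ al] := lP _ sa Ca; apply: lower_le C'x; apply: le_trans al _.
    by rewrite leNgt; apply/negP.
  apply: contrapT => /(uP _ sa)[_ ua]; apply: C'y.
  by apply: lower_le C'a; apply: le_trans ua.
(* Here l is above and u below the cut, which forces s to be empty: U contains every cut and any
   basic set around C will do. *)
- have Ca a : a \in s -> ~ lower C a by move=> sa /(lP _ sa)[].
  have C'a a : a \in s -> lower C a by move=> sa; apply: contrapT => /(uP _ sa)[/(_ Cu)].
  exists [set C' | cut_lt C' (upto l)]; split; first by right; right; eexists.
  split; first by apply/ltP; exists l; rewrite /=.
  by move=> C' _; apply: sU => a sa; have := Ca _ sa (C'a _ sa).
- exists [set C' | cut_lt C' (upto u)]; split; first by right; right; eexists.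
  split=> [|C' /= /ltP[y [C'y /= yu]]]; first by apply/ltP; exists u; rewrite /=.
  apply: sU => a sa; split=> [/(lP _ sa)[]//|C'a].
  apply: contrapT => /(uP _ sa)[_ ua]; apply: C'y.
  by apply: lower_le C'a; apply: le_trans ua.
Qed.

End Units.

(** * Balls and separation of cuts *)

Section Balls.
Variable K : rcfType.
Implicit Types (B : set K) (C : cut K).

(** The differences from the centre form an additive group [M] closed under archimedean domination,
    so any element dominated by a difference of two points of B is a translation of B. *)
Lemma ball_shift B x y z w (n : nat) : is_ball B -> B x -> B y -> B z ->
  `|w| <= n%:R * `|x - y| -> B (z + w).
Proof.
move=> [a [S [[S0 SP] ->]]] Bx By Bz wxy.
pose M t := t = 0 \/ S t.
have BM t : ball_at S a t <-> M (a - t).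
  split=> -[]; [by move=> ->; left; rewrite subrr|by right| |by right].
  by move/eqP; rewrite subr_eq0 eq_sym => /eqP; left.
have Msc t s (k : nat) : M t -> `|s| <= k%:R * `|t| -> M s.
  move=> [->|St] st.
    by left; apply/eqP; rewrite -normr_le0; rewrite normr0 mulr0 in st.
  have [->|s0] := eqVneq s 0; [by left|right].
  by apply: SP St _ _ => //; exists k.
have MD s t : M s -> M t -> M (s + t).
  wlog st : s t / `|s| <= `|t|.
    move=> wl Ms Mt; have [st|/ltW ts] := leP `|s| `|t|; first exact: wl.
    by rewrite addrC; exact: wl.
  move=> _ Mt; apply: (Msc t _ 2) => //; apply: le_trans (ler_normD _ _) _.
  by rewrite mulr_natl mulr2n lerD2r.
have MN s : M s -> M (- s) by move=> Ms; apply: (Msc s _ 1) => //; rewrite normrN mul1r.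
move/BM in Bx; move/BM in By; move/BM in Bz; apply/BM.
have -> : a - (z + w) = (a - z) + - w by ring.
apply: (MD) => //; apply: (MN); apply: (Msc (x - y) _ n) => //.
have -> : x - y = (a - y) + - (a - x) by ring.
by apply: (MD) => //; exact: MN.
Qed.

Lemma ball_nonempty B : is_ball B -> exists a, B a.
Proof. by move=> [a [S [_ ->]]]; exists a; left. Qed.

Lemma ball_convex B x y z : is_ball B -> B x -> B y -> x <= z <= y -> B z.
Proof.
move=> HB Bx By /andP[xz zy]; rewrite -[z](subrKC x).
apply: (ball_shift (x := y) (y := x) (n := 1)) => //.
by rewrite mul1r !ger0_norm ?subr_ge0 ?lerB // (le_trans xz).
Qed.

Lemma ball_reflect B x y : is_ball B -> B x -> B y -> B (2 * x - y).
Proof.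
move=> HB Bx By; have -> : 2 * x - y = x + (x - y) by ring.
by apply: (ball_shift (x := x) (y := y) (n := 1)) => //; rewrite mul1r.
Qed.

(** Reflection in a and of a gives closure of B - a under negation and doubling, and convexity turns
    doubling into closure under domination by any multiple k. The final segment of values is encoded
    by the nonzero elements of B - a. *)
Lemma ball_of_reflect B : (exists a, B a) ->
  (forall x y z, B x -> B y -> x <= z <= y -> B z) ->
  (forall x y, B x -> B y -> B (2 * x - y)) -> is_ball B.
Proof.
move=> [a Ba] Bc Br.
pose M t := B (a + t).
have MN t : M t -> M (- t).
  by move=> Mt; rewrite /M; have := Br _ _ Ba Mt; congr B; ring.
have M2 t : M t -> M (2 * t).
  by move=> Mt; rewrite /M; have := Br _ _ Mt Ba; congr B; ring.
have M2n k t : M t -> M (2 ^+ k * t).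
  move=> Mt; elim: k => [|k IH]; first by rewrite mul1r.
  by rewrite exprS -mulrA; exact: (M2).
have Mabs t : M t -> M `|t|.
  by move=> Mt; case: (ger0P t) => // _; exact: MN.
have Msc s t (k : nat) : M t -> `|s| <= k%:R * `|t| -> M s.
  move=> Mt st; have Mk := M2n k _ (Mabs _ Mt).
  have : `|s| <= 2 ^+ k * `|t|.
    apply: le_trans st _; apply: ler_wpM2r => //.
    by rewrite -natrX ler_nat ltnW // ltn_expl.
  rewrite ler_norml => /andP[s1 s2].
  by apply: Bc (MN _ Mk) Mk _; rewrite !lerD2l s1 s2.
exists a, [set t | t != 0 /\ M t]; split.
  split=> [x []//|x z [x0 Mx] z0 [k kP]]; split=> //; exact: Msc Mx kP.
apply/seteqP; split=> b.
  move=> Bb; have [->|ba] := eqVneq b a; [by left|right].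
  rewrite /= subr_eq0 eq_sym ba; split=> //.
  by rewrite -opprB; apply: (MN); rewrite /M subrKC.
move=> [->//|[_ Mb]].
by have := MN _ Mb; rewrite /M opprB subrKC.
Qed.

Definition lower_edge B C := is_minus_in id B C.
Definition upper_edge B C := is_plus_in id B C.

Lemma lower_edgeP B C : lower_edge B C ->
  forall x, lower C x <-> forall b, B b -> x < b.
Proof. by rewrite /lower_edge /is_minus_in => ->. Qed.

Lemma upper_edgeP B C : upper_edge B C ->
  forall x, lower C x <-> exists2 b, B b & x <= b.
Proof.
rewrite /upper_edge /is_plus_in => -> x; split=> [[b [Bb xb]]|[b Bb xb]]; exists b => //.
Qed.

Lemma lower_edge_ball B C x : is_ball B -> lower_edge B C -> B x -> ~ lower C x.
Proof. by move=> HB /lower_edgeP -> Bx /(_ _ Bx); rewrite ltxx. Qed.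

Lemma upper_edge_ball B C x : upper_edge B C -> B x -> lower C x.
Proof. by move=> /upper_edgeP -> Bx; exists x. Qed.

Lemma lower_edge_ex B : exists C, lower_edge B C.
Proof.
have i : is_initial [set x | forall b, B b -> x < b].
  by move=> x y xy yB b /yB; exact: le_lt_trans.
by exists (exist _ _ i).
Qed.

Lemma upper_edge_ex B : exists C, upper_edge B C.
Proof.
have i : is_initial [set x | exists b, B b /\ x <= b].
  by move=> x y xy [b [Bb yb]]; exists b; split=> //; exact: le_trans yb.
by exists (exist _ _ i).
Qed.

Lemma between_edges B C1 C2 x : is_ball B -> lower_edge B C1 -> upper_edge B C2 ->
  B x <-> ~ lower C1 x /\ lower C2 x.
Proof.
move=> HB e1 e2; split=> [Bx|[C1x /(upper_edgeP e2)[b Bb xb]]].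
  by split; [exact: lower_edge_ball Bx|exact: upper_edge_ball Bx].
have [a Ba ax] : exists2 a, B a & a <= x.
  apply: contrapT => h; apply: C1x; apply/(lower_edgeP e1) => a Ba.
  by rewrite ltNge; apply/negP => ax; apply: h; exists a.
by apply: ball_convex Ba Bb _; rewrite ?ax.
Qed.

Lemma edges_sub B C1 C2 x : is_ball B -> lower_edge B C1 -> upper_edge B C2 ->
  lower C1 x -> lower C2 x.
Proof.
move=> /ball_nonempty[b Bb] /lower_edgeP e1 /upper_edgeP e2 /e1/(_ _ Bb)/ltW xb.
by apply/e2; exists b.
Qed.

Definition is_lower_edge C := exists2 B, is_ball B & lower_edge B C.
Definition is_upper_edge C := exists2 B, is_ball B & upper_edge B C.

(** The midpoint m of b in B and b' in B' lies in one of the two balls. Reflecting in m the point of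
    that ball yields the point of the other, on the wrong side of C. *)
Lemma edges_disjoint C : is_upper_edge C -> ~ is_lower_edge C.
Proof.
move=> [B HB /upper_edgeP e] [B' HB' /lower_edgeP e'].
have [b Bb] := ball_nonempty HB; have [b' Bb'] := ball_nonempty HB'.
have bb' : b < b' by have /e' := (e b).2 (ex_intro2 _ _ b Bb (lexx b)); apply.
pose m := (b + b') / 2.
have [Cm|Cm] := pselect (lower C m).
  have [c Bc mc] := (e m).1 Cm.
  have Bm : B m by apply: ball_convex Bb Bc _; rewrite // /m mc andbT; lra.
  have /e'/(_ b' Bb') : lower C b'.
    by apply/e; exists (2 * m - b); [exact: ball_reflect|rewrite /m; lra].
  by rewrite ltxx.
have [c Bc cm] : exists2 c, B' c & c <= m.
  apply: contrapT => h; apply: Cm; apply/e' => c Bc.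
  by rewrite ltNge; apply/negP => cm; apply: h; exists c.
have Bm : B' m by apply: ball_convex Bc Bb' _; rewrite // cm /m; lra.
have /e' : lower C b by apply/e; exists b.
by move=> /(_ (2 * m - b') (ball_reflect HB' Bm Bb')); rewrite /m; lra.
Qed.

Lemma ball_symmetric (M : set K) a : M 0 ->
  (forall s t, 0 <= s <= t -> M t -> M s) -> (forall t, 0 <= t -> M t -> M (2 * t)) ->
  is_ball [set b | M `|b - a|].
Proof.
move=> M0 Mle M2; apply: ball_of_reflect => /=.
- by exists a; rewrite subrr normr0.
- move=> x y z Mx My /andP[xz zy].
  have [h|h] := leP `|x - a| `|y - a|; [apply: Mle My|apply: Mle Mx];
    rewrite normr_ge0 /=; move: h;
    by case: (ger0P (x - a)); case: (ger0P (y - a)); case: (ger0P (z - a)); lra.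
- move=> x y Mx My.
  (* With t the larger of the two distances to a, the bound below is at most 3t; two doublings of t
     give 4t. *)
  have Mk t s : 0 <= s <= 4 * t -> 0 <= t -> M t -> M s.
    move=> st t0 Mt; apply: Mle st _; have -> : 4 * t = 2 * (2 * t) by ring.
    by apply: (M2); [lra|apply: (M2)].
  have E : 2 * x - y - a = 2 * (x - a) - (y - a) by ring.
  have H : `|2 * x - y - a| <= 2 * `|x - a| + `|y - a|.
    by rewrite E; apply: le_trans (ler_normB _ _) _; rewrite normrM [`|2|]ger0_norm.
  have := normr_ge0 (x - a); have := normr_ge0 (y - a).
  by have [h|h] := leP `|x - a| `|y - a|; move=> *;
    [apply: Mk My|apply: Mk Mx] => //; rewrite normr_ge0 /=; lra.
Qed.

(** If halving the distance to x never crossed the cut, the radii t with x - t above the cut would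
    be closed under doubling, and C would be the lower edge of the corresponding ball around x. *)
Lemma not_lower_edge C x : ~ is_lower_edge C -> ~ lower C x ->
  exists2 m, lower C m & ~ lower C ((m + x) / 2).
Proof.
move=> nC Cx; apply: contrapT => h; apply: nC.
have half m : lower C m -> lower C ((m + x) / 2).
  by move=> Cm; apply: contrapT => Cmx; apply: h; exists m.
exists [set b | ~ lower C (x - `|b - x|)].
  apply: (@ball_symmetric (fun t => ~ lower C (x - t))) => [|s t /andP[_ st] Ct Cs|t t0 Ct].
  - by rewrite subr0.
  - by apply: Ct; apply: lower_le Cs; rewrite lerB.
  - by move=> /half; have -> : (x - 2 * t + x) / 2 = x - t by field.
apply/funext => y /=; apply/propext; split=> [Cy b /= Cb|yB].
  apply: lt_le_trans (lower_lt Cy Cb) _.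
  by case: (ger0P (b - x)); lra.
apply: contrapT => Cy.
have yx : y < x by apply: yB; rewrite /= subrr normr0 subr0.
have := yB y; rewrite /= ltxx => yy; apply: notF; apply: yy.
by rewrite distrC gtr0_norm ?subr_gt0 // subKr.
Qed.

Lemma not_upper_edge C x : ~ is_upper_edge C -> lower C x ->
  exists2 m, ~ lower C m & lower C ((m + x) / 2).
Proof.
move=> nC Cx; apply: contrapT => h; apply: nC.
have half m : ~ lower C m -> ~ lower C ((m + x) / 2).
  by move=> Cm Cmx; apply: h; exists m.
exists [set b | lower C (x + `|b - x|)].
  apply: (@ball_symmetric (fun t => lower C (x + t))) => [|s t /andP[_ st] Ct|t t0 Ct].
  - by rewrite addr0.
  - by apply: lower_le Ct; rewrite lerD2l.
  - apply: contrapT => /half; have -> : (x + 2 * t + x) / 2 = x + t by field.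
    exact.
apply/funext => y /=; apply/propext; split=> [Cy|[b /= [Cb yb]]].
  have [xy|yx] := leP x y.
    by exists y; rewrite /= lexx ger0_norm ?subr_ge0 // subrKC.
  by exists x; rewrite /= subrr normr0 addr0 ltW.
by apply: lower_le Cb; apply: le_trans yb _; case: (ger0P (b - x)); lra.
Qed.

Lemma eval_affine C (a b : K) :
  near C (fun x => ratfun_eval (polyfrac (a *: ('X - b%:P))) x = a * (x - b)).
Proof. by apply: near1 (eval_poly C (a *: ('X - b%:P))) => x ->; rewrite !hornerE. Qed.

(* If [m] lies below the cut and the midpoint of [m] and [x] above it, then
   [(x - y) / (x - m)] has its values in [1/2, 1] at the cut. *)
Lemma separate_above_mid C m x : lower C m -> ~ lower C ((m + x) / 2) ->
  exists g, unit_pos (pos C) g /\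
    forall C', unit_pos (pos C') g -> ~ lower C' x.
Proof.
move=> Cm Cmx; have mx := lower_lt Cm Cmx; have xm0 : 0 < x - m by lra.
exists (polyfrac (- (x - m)^-1 *: ('X - x%:P))); split.
  apply: unit_pos_half_one.
  apply: near1 (nearI (eval_affine C (- (x - m)^-1) x) (nearI (near_lower Cm) (near_upper Cmx))).
  move=> y [-> [my ymx]].
  have -> : - (x - m)^-1 * (y - x) = (x - y) / (x - m) by field; lra.
  by rewrite ler_pdivlMr // ler_pdivrMr //; apply/andP; split; lra.
move=> C' /unit_pos_gt0 g0 C'x.
have [y [+ [E xy]]] := near_ex (nearI g0
  (nearI (eval_affine C' (- (x - m)^-1) x) (near_lower C'x))).
rewrite E nmulr_rgt0 ?oppr_lt0 ?invr_gt0 //; lra.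
Qed.

Lemma separate_below_mid C m x : ~ lower C m -> lower C ((m + x) / 2) ->
  exists g, unit_pos (pos C) g /\
    forall C', unit_pos (pos C') g -> lower C' x.
Proof.
move=> Cm Cmx; have xm := lower_lt Cmx Cm; have xm0 : 0 < m - x by lra.
exists (polyfrac ((m - x)^-1 *: ('X - x%:P))); split.
  apply: unit_pos_half_one.
  apply: near1 (nearI (eval_affine C (m - x)^-1 x) (nearI (near_upper Cm) (near_lower Cmx))).
  move=> y [-> [my ymx]].
  have -> : (m - x)^-1 * (y - x) = (y - x) / (m - x) by field; lra.
  by rewrite ler_pdivlMr // ler_pdivrMr //; apply/andP; split; lra.
move=> C' /unit_pos_gt0 g0; apply: contrapT => C'x.
have [y [+ [E xy]]] := near_ex (nearI g0 (nearI (eval_affine C' (m - x)^-1 x) (near_upper C'x))).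
by rewrite E pmulr_rgt0 ?invr_gt0 //; lra.
Qed.

Lemma separate_above C x : ~ is_lower_edge C -> ~ lower C x ->
  exists g, unit_pos (pos C) g /\
    forall C', unit_pos (pos C') g -> ~ lower C' x.
Proof. by move=> nC /(not_lower_edge nC)[m]; exact: separate_above_mid. Qed.

Lemma separate_below C x : ~ is_upper_edge C -> lower C x ->
  exists g, unit_pos (pos C) g /\
    forall C', unit_pos (pos C') g -> lower C' x.
Proof. by move=> nC /(not_upper_edge nC)[m]; exact: separate_below_mid. Qed.

(* Two cuts are the edges of a ball as soon as the gap between them is closed
   under reflecting one point in another; if it is not, three points of an
   arithmetic progression witness that the places differ. *)
Lemma edges_of_reflect C1 C2 : (forall x, lower C1 x -> lower C2 x) -> C1 <> C2 ->
  (forall x y, ~ lower C1 x -> lower C2 x -> ~ lower C1 y -> lower C2 y ->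
     ~ lower C1 (2 * x - y) /\ lower C2 (2 * x - y)) ->
  exists2 B, is_ball B & lower_edge B C1 /\ upper_edge B C2.
Proof.
move=> sub n refl; have [a [C1a C2a]] := lower_neq n sub.
exists [set x | ~ lower C1 x /\ lower C2 x].
  apply: ball_of_reflect => [|x y z [C1x _] [_ C2y] /andP[xz zy]|x y [? ?] [? ?]].
  - by exists a.
  - by split; [move=> /(lower_le xz)|exact: lower_le C2y].
  - exact: refl.
split; apply/funext => x /=; apply/propext; split.
- by move=> C1x b [/= C1b _]; exact: lower_lt C1b.
- move=> xB; apply: contrapT => C1x; have [xa|/ltW ax] := leP x a.
    by have := xB x (conj C1x (lower_le xa C2a)); rewrite ltxx.
  by have := xB a (conj C1a C2a); rewrite ltNge ax.
- move=> C2x; have [xa|/ltW ax] := leP x a; first by exists a.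
  by exists x; split=> //; split=> // /(lower_le ax).
- by move=> [b /= [[_ C2b] xb]]; exact: lower_le C2b.
Qed.

Lemma edges_equiv B C1 C2 : is_ball B -> lower_edge B C1 -> upper_edge B C2 ->
  cut_equiv C1 C2.
Proof. by move=> HB e1 e2; right; exists B; split=> //; left. Qed.

Lemma cut_equiv_sym C1 C2 : cut_equiv C1 C2 -> cut_equiv C2 C1.
Proof.
case=> [->|[B [HB [[? ?]|[? ?]]]]]; first by left.
  by right; exists B; split=> //; right.
by right; exists B; split=> //; left.
Qed.

Lemma cut_equivP C1 C2 : cut_equiv C1 C2 <-> C1 = C2 \/ exists2 B, is_ball B &
  (lower_edge B C1 /\ upper_edge B C2) \/ (upper_edge B C1 /\ lower_edge B C2).
Proof.
by split=> -[->|[B]]; [left|case; right; exists B|left|right; exists B].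
Qed.

Lemma cut_place_inj C1 C2 : cut_place C1 = cut_place C2 -> cut_equiv C1 C2.
Proof.
wlog sub : C1 C2 / forall x, lower C1 x -> lower C2 x => [wl E|E].
  have [s|s] := lower_total C1 C2; first exact: wl.
  by apply/cut_equiv_sym/wl.
have upE g : unit_pos (pos C1) g <-> unit_pos (pos C2) g.
  by rewrite -!Hp_cut_place E.
have [->|n] := pselect (C1 = C2); first by left.
have [//|B HB [e1 e2]] := edges_of_reflect sub n _; last exact: edges_equiv e1 e2.
move=> x y C1x C2x C1y C2y.
(* If the reflected point left the gap, it and y would have the midpoint x on the other side of a
   cut, which is the configuration separated by a linear function. *)
have E2 : (2 * x - y + y) / 2 = x by field.
split.
  move=> C1m; have [|g [g1 g2]] := @separate_above_mid C1 _ y C1m; first by rewrite E2.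
  by apply: (g2 C2) => //; apply/upE.
apply: contrapT => C2m.
have [|g [g1 g2]] := @separate_below_mid C2 _ y C2m; first by rewrite E2.
by apply/C1y/g2/upE.
Qed.

End Balls.

(** * Places at the edges of a ball *)

Section Edges.
Variable K : rcfType.
Implicit Types (B : set K) (C : cut K).

Lemma rcf_root (t : K) j : 0 < t -> (0 < j)%N -> exists2 r, 0 < r & r ^+ j = t.
Proof.
move=> t0 j0; have [||r /andP[r0 _]] := @poly_ivt K ('X^j - t%:P) 0 (1 + t).
- lra.
- rewrite !hornerE expr0n gtn_eqF //= sub0r oppr_le0 ltW //=.
  rewrite subr_ge0; apply: (@le_trans _ _ (1 + t)); first by lra.
  by apply: ler_eXnr => //; lra.
rewrite rootE !hornerE subr_eq0 => /eqP rt; exists r => //.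
rewrite lt_def r0 andbT; apply: contraTneq t0 => r00.
by rewrite -rt r00 expr0n gtn_eqF // ltxx.
Qed.

Definition is_edge B C := lower_edge B C \/ upper_edge B C.

(** Together with the next lemma: at either edge, |y - a| exceeds every radius inside the ball and
    is below every radius outside it. *)
Lemma edge_norm_ge B C a r : is_ball B -> is_edge B C -> B a -> 0 <= r ->
  B (a + r) -> near C (fun x => r <= `|x - a|).
Proof.
move=> HB eC Ba r0 Bar; case: eC => e.
  have Bar' : B (a - r) by have := ball_reflect HB Ba Bar; congr B; ring.
  apply: near1 (near_upper (lower_edge_ball HB e Bar')) => x.
  by case: (ger0P (x - a)); lra.
apply: near1 (near_lower (upper_edge_ball e Bar)) => x.
by case: (ger0P (x - a)); lra.
Qed.

Lemma edge_norm_le B C a r : is_ball B -> is_edge B C -> B a -> 0 <= r ->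
  ~ B (a + r) -> near C (fun x => `|x - a| <= r).
Proof.
move=> HB eC Ba r0 Bar; case: eC => e.
  have Ca := lower_edge_ball HB e Ba.
  have Car : lower C (a - r).
    apply/(lower_edgeP e) => b Bb; rewrite ltNge; apply/negP => bar; apply: Bar.
    have Bar' : B (a - r) by apply: ball_convex Bb Ba _; rewrite ?bar //=; lra.
    by have := ball_reflect HB Ba Bar'; congr B; ring.
  apply: near1 (nearI (near_lower Car) (near_upper Ca)) => x.
  by case: (ger0P (x - a)); lra.
have Ca := upper_edge_ball e Ba.
have Car : ~ lower C (a + r).
  move=> /(upper_edgeP e)[b Bb arb]; apply: Bar.
  by apply: ball_convex Ba Bb _; rewrite ?arb ?andbT //; lra.
apply: near1 (nearI (near_lower Ca) (near_upper Car)) => x.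
by case: (ger0P (x - a)); lra.
Qed.

(** Extracting a j-th root r of |d/c| reduces the comparison to whether a + r lies in B. That
    question does not involve C, so the same alternative holds at both edges, and a ball absorbs the
    factor n. *)
Lemma edge_compare B a (c d : K) j : is_ball B -> B a -> c != 0 -> d != 0 ->
  (0 < j)%N ->
  (forall C (n : nat), is_edge B C ->
     near C (fun x => n%:R * `|d| <= `|c * (x - a) ^+ j|)) \/
  (forall C (n : nat), is_edge B C ->
     near C (fun x => n%:R * `|c * (x - a) ^+ j| <= `|d|)).
Proof.
move=> HB Ba c0 d0 j0.
have c0' : 0 < `|c| by rewrite normr_gt0.
have d0' : 0 < `|d| by rewrite normr_gt0.
have [r r0 rj] := rcf_root (divr_gt0 d0' c0') j0.
have dE : `|d| = `|c| * r ^+ j by rewrite rj mulrC divfK // lt0r_neq0.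
have nj (n : nat) : n.+1%:R <= n.+1%:R ^+ j :> K.
  by apply: ler_eXnr; rewrite // ler1n.
have [Bar|Bar] := pselect (B (a + r)); [left|right] => C n eC.
  have nr0 : 0 <= n.+1%:R * r by rewrite mulr_ge0 // ltW.
  apply: near1 (edge_norm_ge HB eC Ba nr0 _) => [x nx|].
    rewrite normrM normrX dE mulrCA ler_pM2l //.
    apply: (@le_trans _ _ ((n.+1%:R * r) ^+ j)).
      rewrite exprMn; apply: ler_wpM2r; first by rewrite exprn_ge0 // ltW.
      by apply: le_trans (nj n); rewrite ler_nat.
    by apply: lerXn2r; rewrite ?nnegrE.
  apply: (ball_shift (x := a + r) (y := a) (n := n.+1)) => //.
  by rewrite addrAC subrr add0r normrM ger0_norm.
have n0 : 0 < n.+1%:R :> K by rewrite ltr0n.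
have nr0 : 0 <= r / n.+1%:R by rewrite divr_ge0 // ltW.
apply: near1 (edge_norm_le HB eC Ba nr0 _) => [x nx|].
  rewrite normrM normrX dE mulrCA ler_pM2l //.
  apply: (@le_trans _ _ (n.+1%:R ^+ j * `|x - a| ^+ j)).
    apply: ler_wpM2r; first by rewrite exprn_ge0.
    by apply: le_trans (nj n); rewrite ler_nat.
  rewrite -exprMn; apply: lerXn2r; rewrite ?nnegrE ?mulr_ge0 // ?(ltW r0) //.
  by rewrite mulrC -ler_pdivlMr.
move=> Barn; apply: Bar.
apply: (ball_shift (x := a + r / n.+1%:R) (y := a) (n := n.+1)) => //.
rewrite addrAC subrr add0r normrM ger0_norm ?(ltW r0) //.
rewrite [`|_^-1|]ger0_norm ?invr_ge0 ?(ltW n0) //.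
by rewrite mulrCA divff ?mulr1 ?pnatr_eq0.
Qed.

(* At the edges of a ball with centre [a] the value of [y - a] is not in the
   value group of [K], so one monomial of a polynomial in [y - a] dominates. *)
Lemma edge_dominant B a (p : {poly K}) : is_ball B -> B a -> p != 0 ->
  exists c k, c != 0 /\ forall C (n : nat), is_edge B C ->
    near C (fun x => n%:R * `|p.[x] - c * (x - a) ^+ k| <= `|c * (x - a) ^+ k|).
Proof.
move=> HB Ba.
suff H (q : {poly K}) : q != 0 -> exists c k, c != 0 /\ forall C (n : nat), is_edge B C ->
    near C (fun x => n%:R * `|q.[x - a] - c * (x - a) ^+ k| <= `|c * (x - a) ^+ k|).
  move=> p0; have pE : p = (p \Po ('X + a%:P)) \Po ('X - a%:P).
    by rewrite -comp_polyA comp_polyD comp_polyX comp_polyC subrK comp_polyXr.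
  have [|c [k [c0 H']]] := H (p \Po ('X + a%:P)).
    by apply: contraNneq p0 => q0; rewrite pE q0 comp_poly0.
  exists c, k; split=> // C n eC; apply: near1 (H' C n eC) => x.
  by rewrite {2}pE [X in _ -> _ * `|X - _| <= _]horner_comp !hornerE.
elim/poly_ind: q => [|q c0 IH]; first by rewrite eqxx.
have [-> |q0 _] := eqVneq q 0.
  rewrite mul0r add0r polyC_eq0 => c00; exists c0, 0%N; split=> // C n _.
  by apply: nearW => x; rewrite hornerC expr0 mulr1 subrr normr0 mulr0.
have [c [k [cn0 H]]] := IH q0.
have HE x t : (q * 'X + c0%:P).[t] - x = (q.[t] * t + c0) - x by rewrite !hornerE.
have HS t : c * t ^+ k.+1 = (c * t ^+ k) * t by rewrite exprSr mulrA.
have [c00|c00] := eqVneq c0 0.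
  exists c, k.+1; split=> // C n eC; apply: near1 (H C n eC) => x h.
  rewrite HE c00 addr0 HS -mulrBl !normrM mulrA; apply: ler_wpM2r => //.
  by rewrite -normrM.
have [D|D] := edge_compare (j := k.+1) HB Ba cn0 c00 isT.
  (* The factor 2n leaves half of the allowed error to the old remainder times t and half to the
     constant c0. *)
  exists c, k.+1; split=> // C n eC.
  apply: near1 (nearI (H C (2 * n)%N eC) (D C (2 * n)%N eC)) => x.
  rewrite HE HS natrM; move: (x - a) => t [h1 h2].
  have -> : q.[t] * t + c0 - c * t ^+ k * t = (q.[t] - c * t ^+ k) * t + c0 by ring.
  have h3 : 2 * n%:R * `|(q.[t] - c * t ^+ k) * t| <= `|c * t ^+ k * t|.
    by rewrite !(normrM _ t) mulrA; apply: ler_wpM2r.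
  have := ler_wpM2l (ler0n K n) (ler_normD ((q.[t] - c * t ^+ k) * t) c0).
  move: h2 h3; rewrite mulrDr -!mulrA; set u := _ * `|c0|; set v := n%:R * `|_ * t|; lra.
exists c0, 0%N; split=> // C n eC.
apply: near1 (nearI (H C 1%N eC) (D C (2 * n)%N eC)) => x.
rewrite HE HS expr0 mulr1 natrM; move: (x - a) => t [h1 h2].
rewrite mul1r in h1; rewrite addrK normrM.
apply: le_trans h2; rewrite normrM mulrA [2 * _]mulrC mulrA; apply: ler_wpM2r => //.
rewrite -mulrA; apply: ler_wpM2l => //.
rewrite -[q.[t]](subrK (c * t ^+ k)); apply: le_trans (ler_normD _ _) _; lra.
Qed.

(** After cancelling the common power, [edge_compare] with the factor N + 1 contradicts
    comparability up to N: no positive multiple of the value of y - a lies in vK. *)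
Lemma edge_incomparable B C a (c d : K) k l (N : nat) : is_ball B -> B a ->
  is_edge B C -> c != 0 -> d != 0 -> k <> l ->
  ~ near C (fun x => `|c * (x - a) ^+ k| <= N%:R * `|d * (x - a) ^+ l| /\
                     `|d * (x - a) ^+ l| <= N%:R * `|c * (x - a) ^+ k|).
Proof.
move=> HB Ba eC; wlog lk : k l c d / (l < k)%N => [wl c0 d0 kl|c0 d0 _ h].
  have [|lk|/esym//] := ltngtP l k; first by move=> lk; exact: wl.
  by move=> h; apply: (wl l k d c) => //; [move/esym|apply: near1 h => x []].
have kE : k = (k - l + l)%N by exact/esym/subnK/ltnW.
have j0 : (0 < k - l)%N by rewrite subn_gt0.
have := edge_compare HB Ba c0 d0 j0; move: kE; move: (k - l)%N => j kE.
case=> /(_ C N.+1 eC) D;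
  have [x [D' [xa [h1 h2]]]] := near_ex (nearI D (nearI (near_neq C a) h));
  move: D' h1 h2; rewrite kE exprD mulrA !normrM ![_ * (_ * `|(x - a) ^+ l|)]mulrA;
  have t0 : 0 < `|(x - a) ^+ l| by rewrite normr_gt0 expf_neq0 // subr_eq0.
  rewrite !ler_pM2r // -natr1 mulrDl mul1r => h0 h1 _.
  have := le_trans h0 h1; have : 0 < `|d| by rewrite normr_gt0.
  by set u := _ * `|d|; lra.
rewrite !ler_pM2r // -natr1 mulrDl mul1r => h0 _ h1.
have := le_trans h0 h1; have : 0 < `|c| * `|(x - a) ^+ j|.
  by rewrite mulr_gt0 // normr_gt0 // expf_neq0 // subr_eq0.
by set u := `|c| * _; set v := _ * u; lra.
Qed.

(** Near the edges p/q behaves like (c/d)(y - a)^(k - l). A unit forces k = l, and then the sign is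
    that of c d, the same at both edges. *)
Lemma edge_unit_pos B C1 C2 g : is_ball B -> is_edge B C1 -> is_edge B C2 ->
  unit_pos (pos C1) g -> pos C2 g.
Proof.
move=> HB e1 e2; elim/ratfun_ind: g => p q q0 /unit_posP[N gN].
have [a Ba] := ball_nonempty HB.
have n0 : (0 : K) < N.+1%:R by rewrite ltr0n.
have [p0|p0] := eqVneq p 0.
  have [x [+ [qx E]]] := near_ex (nearI gN (eval_frac C1 p q0)).
  by rewrite E p0 horner0 mul0r invr_le0 leNgt n0.
have [c [k [c0 cP]]] := edge_dominant HB Ba p0.
have [d [l [d0 dP]]] := edge_dominant HB Ba q0.
have near_u (u v : K) : 2%:R * `|v - u| <= `|u| -> `|u| <= 2 * `|v| /\ `|v| <= 2 * `|u|.
  by case: (ger0P u); case: (ger0P v); case: (ger0P (v - u)); split; lra.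
have sgn (u v : K) : u != 0 -> 2%:R * `|v - u| <= `|u| -> 0 < v * u.
  move=> u0 h; have [u1|u1] := ltrP 0 u.
    by rewrite pmulr_lgt0 //; move: h; rewrite (gtr0_norm u1); case: (ger0P (v - u)); lra.
  have u2 : u < 0 by rewrite lt_neqAle u0.
  by rewrite nmulr_lgt0 //; move: h; rewrite (ltr0_norm u2); case: (ger0P (v - u)); lra.
have kl : k = l.
  (* The constant 4(N + 1) is the bound N + 1 for g times a factor 2 for each passage from a
     polynomial to its dominant monomial. *)
  apply: contrapT => kl; apply: (@edge_incomparable B C1 a c d k l (4 * N.+1)%N) => //.
  have := nearI gN (nearI (eval_frac C1 p q0) (nearI (cP C1 2%N e1) (dP C1 2%N e1))).
  apply: near1 => x [+ [[qx E] +]]; rewrite E.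
  move: (c * _) (d * _) => u v + [/near_u[u1 u2] /near_u[v1 v2]].
  move=> /andP[g1 g2]; have q1 : 0 < `|q.[x]| by rewrite normr_gt0.
  have pq0 : 0 <= p.[x] / q.[x] by apply: le_trans g1; rewrite invr_ge0 ltW.
  have pqE : `|p.[x]| = p.[x] / q.[x] * `|q.[x]|.
    by rewrite -(ger0_norm pq0) -normrM divfK.
  have h2 : `|p.[x]| <= N.+1%:R * `|q.[x]| by rewrite pqE ler_pM2r.
  have h1 : `|q.[x]| <= N.+1%:R * `|p.[x]|.
    rewrite pqE mulrA ler_peMl //.
    by rewrite mulrC -ler_pdivrMr // mul1r.
  rewrite natrM; split.
    apply: le_trans u1 _; have := ler_wpM2l (ltW n0) v2; rewrite mulrCA; lra.
  apply: le_trans v1 _; have := ler_wpM2l (ltW n0) u2; rewrite mulrCA; lra.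
have xk x : x != a -> (c * (x - a) ^+ k != 0) * (d * (x - a) ^+ k != 0).
  by move=> xa; split; rewrite mulf_neq0 ?expf_neq0 // subr_eq0.
have cd0 : 0 < c * d.
  have [x [g1 [[qx E] [xa [h1 h2]]]]] := near_ex (nearI gN (nearI (eval_frac C1 p q0)
    (nearI (near_neq C1 a) (nearI (cP C1 2%N e1) (dP C1 2%N e1))))).
  rewrite -kl in h2; have [xc xd] := xk _ xa.
  have := mulr_gt0 (sgn _ _ xc h1) (sgn _ _ xd h2).
  have -> : p.[x] * (c * (x - a) ^+ k) * (q.[x] * (d * (x - a) ^+ k)) =
    (c * d) * (p.[x] / q.[x] * (q.[x] * (x - a) ^+ k) ^+ 2) by field.
  rewrite pmulr_lgt0 // mulr_gt0 //; last first.
    by rewrite lt_def sqr_ge0 andbT expf_neq0 // mulf_neq0 // expf_neq0 // subr_eq0.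
  rewrite -E; case/andP: g1 => g1 _; apply: lt_le_trans g1; by rewrite invr_gt0.
apply: near1 (nearI (eval_frac C2 p q0)
    (nearI (near_neq C2 a) (nearI (cP C2 2%N e2) (dP C2 2%N e2)))).
move=> x [[qx ->] [xa [h1 h2]]]; rewrite -kl in h2; have [xc xd] := xk _ xa.
have := mulr_gt0 (sgn _ _ xc h1) (sgn _ _ xd h2).
have -> : p.[x] * (c * (x - a) ^+ k) * (q.[x] * (d * (x - a) ^+ k)) =
    (c * d) * (p.[x] / q.[x] * (q.[x] * (x - a) ^+ k) ^+ 2) by field.
rewrite pmulr_rgt0 // pmulr_lgt0; first by move/ltW.
by rewrite lt_def sqr_ge0 andbT expf_neq0 // mulf_neq0 // expf_neq0 // subr_eq0.
Qed.

Lemma edge_place B C1 C2 : is_ball B -> is_edge B C1 -> is_edge B C2 ->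
  cut_place C1 = cut_place C2.
Proof.
move=> HB e1 e2; apply: place_eq_lam; [exact: cut_placeP|exact: pos_ordering|].
by move=> g /Hp_cut_place; exact: edge_unit_pos e1 e2.
Qed.

Lemma cut_equiv_place C1 C2 : cut_equiv C1 C2 <-> cut_place C1 = cut_place C2.
Proof.
split=> [/cut_equivP[->//|[B HB e]]|]; last exact: cut_place_inj.
by apply: (edge_place HB); case: e => -[? ?]; [left|right|right|left].
Qed.

End Edges.

(** * The full topology and restriction of cuts *)

Section FullTopology.
Variable K : rcfType.
Implicit Types (B : set K) (C : cut K).

Lemma unit_pos1 C : unit_pos (pos C) 1.
Proof. by apply/Hp_cut_place; exists 1; rewrite (place1 (cut_placeP C)) ltr01. Qed.

(* With [c] the midpoint of [x, y] and [h] half its length, [1 - h^2 / (y - c)^2]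
   has value 1 at the edges of the ball and is negative between [x] and [y]. *)
Lemma separate_inside B C x y : is_ball B -> is_edge B C -> B x -> B y ->
  exists g, unit_pos (pos C) g /\
    forall C', unit_pos (pos C') g -> lower C' x -> lower C' y.
Proof.
move=> HB eC Bx By; have [yx|xy] := leP y x.
  exists 1; split; first exact: unit_pos1.
  by move=> C' _; exact: lower_le.
pose c := (x + y) / 2; pose h := (y - x) / 2.
have h0 : 0 < h by rewrite /h; lra.
have Bc : B c by apply: ball_convex Bx By _ => //; rewrite /c; lra.
(* With 2h still a radius of B, |y - c| >= 2h holds at the edges, so that 1 - h^2/(y - c)^2 lies in
   [3/4, 1]. *)
have Bch : B (c + 2 * h).
  apply: (ball_shift (x := x) (y := y) (n := 1)) => //.
  by rewrite mul1r distrC !gtr0_norm /h; lra.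
have q0 : ('X - c%:P) ^+ 2 != 0 by rewrite expf_neq0 // polyXsubC_eq0.
pose g := polyfrac (('X - c%:P) ^+ 2 - (h ^+ 2)%:P) / polyfrac (('X - c%:P) ^+ 2).
have gE D : near D (fun x => x - c != 0 /\
    ratfun_eval g x = ((x - c) ^+ 2 - h ^+ 2) / (x - c) ^+ 2).
  apply: near1 (eval_frac D (('X - c%:P) ^+ 2 - (h ^+ 2)%:P) q0) => t [+ ->].
  rewrite !hornerE => tc.
  by split=> //; apply: contraNneq tc => ->; rewrite expr0n.
exists g; split.
  apply: unit_pos_half_one; have h20 : 0 <= 2 * h by lra.
  apply: near1 (nearI (gE C) (edge_norm_ge HB eC Bc h20 Bch)) => t [[tc ->] ht].
  have t0 : 0 < (t - c) ^+ 2 by rewrite lt_def sqr_ge0 expf_neq0.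
  rewrite ler_pdivlMr // ler_pdivrMr // mul1r.
  have : (2 * h) ^+ 2 <= (t - c) ^+ 2.
    by rewrite -[leRHS](real_normK (num_real _)); apply: lerXn2r; rewrite ?nnegrE.
  have -> : (2 * h) ^+ 2 = 4 * h ^+ 2 by ring.
  have := sqr_ge0 h; move: t0; move: (h ^+ 2) ((t - c) ^+ 2) => u v.
  by move=> *; apply/andP; split; lra.
move=> C' /unit_pos_gt0 g0 C'x; apply: contrapT => C'y.
have [t [+ [[tc E] [xt ty]]]] := near_ex (nearI g0 (nearI (gE C')
  (nearI (near_lower C'x) (near_upper C'y)))).
have t0 : 0 < (t - c) ^+ 2 by rewrite lt_def sqr_ge0 expf_neq0.
rewrite E pmulr_lgt0 ?invr_gt0 // subr_gt0 ltNge.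
have -> // : (t - c) ^+ 2 <= h ^+ 2.
rewrite -[leLHS](real_normK (num_real _)); apply: lerXn2r; rewrite ?nnegrE ?(ltW h0) //.
by rewrite ler_norml /h /c; apply/andP; split; lra.
Qed.

(** Away from edges, each point of s is kept on its side by a linear unit. At an edge of B, U
    contains both edges; units fix the side of the points of s outside B and force those inside B to
    lie all on one side. *)
Lemma full_open_nbhd (U : set (cut K)) C : full_open U -> U C ->
  exists bs : seq (ratfun K), (forall b, b \in bs -> unit_pos (pos C) b) /\
    forall C', (forall b, b \in bs -> unit_pos (pos C') b) -> U C'.
Proof.
move=> [fU /interval_openP oU] UC.
have [[B HB eC]|nC] := pselect (exists2 B, is_ball B & is_edge B C); last first.
  have nl : ~ is_lower_edge C by move=> [B HB e]; apply: nC; exists B => //; left.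
  have nu : ~ is_upper_edge C by move=> [B HB e]; apply: nC; exists B => //; right.
  have /choice[G GP] : forall a, exists g, unit_pos (pos C) g /\
      forall C', unit_pos (pos C') g -> lower C a <-> lower C' a.
    move=> a; have [Ca|Ca] := pselect (lower C a).
      have [g [g1 g2]] := separate_below nu Ca; exists g; split=> // C' C'g.
      by split=> // _; exact: g2.
    have [g [g1 g2]] := separate_above nl Ca; exists g; split=> // C' C'g.
    by split=> // C'a; case: (g2 _ C'g).
  have [s sU] := oU _ UC; exists (map G s); split.
    by move=> _ /mapP[a _ ->]; apply: (GP a).1.
  move=> C' C'P; apply: sU => a sa; apply: (GP a).2; apply: C'P; exact: map_f.
have [C1 e1] := lower_edge_ex B; have [C2 e2] := upper_edge_ex B.
have E12 : cut_place C1 = cut_place C /\ cut_place C2 = cut_place C.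
  by split; apply: (edge_place HB) => //; [left|right].
have UC1 : U C1 by apply: fU UC _; apply/cut_equiv_place/esym/E12.1.
have UC2 : U C2 by apply: fU UC _; apply/cut_equiv_place/esym/E12.2.
have [s1 sU1] := oU _ UC1; have [s2 sU2] := oU _ UC2.
have up1 g : unit_pos (pos C1) g -> unit_pos (pos C) g.
  by rewrite -!Hp_cut_place E12.1.
have up2 g : unit_pos (pos C2) g -> unit_pos (pos C) g.
  by rewrite -!Hp_cut_place E12.2.
have nC1 : ~ is_upper_edge C1 by move=> /edges_disjoint; apply; exists B.
have nC2 : ~ is_lower_edge C2 by move=> /edges_disjoint; apply; exists B.
have /choice[G GP] : forall a, exists g, unit_pos (pos C) g /\
    forall C', unit_pos (pos C') g ->
      (lower C1 a -> lower C' a) /\ (~ lower C2 a -> ~ lower C' a).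
  move=> a; have [Ca|Ca] := pselect (lower C1 a).
    have [g [/up1 g1 g2]] := separate_below nC1 Ca; exists g; split=> // C' C'g.
    split=> [_|]; first exact: g2.
    by case; exact: (edges_sub HB e1 e2 Ca).
  have [C2a|C2a] := pselect (lower C2 a); first by exists 1; split; [exact: unit_pos1|].
  have [g [/up2 g1 g2]] := separate_above nC2 C2a; exists g; split=> // C' C'g.
  by split=> // _; exact: g2.
have /choice[H HP] : forall a : K * K, exists g, unit_pos (pos C) g /\
    forall C', unit_pos (pos C') g -> B a.1 -> B a.2 -> lower C' a.1 -> lower C' a.2.
  move=> [x y] /=; have [[Bx By]|nB] := pselect (B x /\ B y).
    have [g [g1 g2]] := separate_inside HB eC Bx By.
    by exists g; split=> // C' /g2.
  by exists 1; split; [exact: unit_pos1|move=> C' _ Bx By; case: nB].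
pose s := s1 ++ s2; exists (map G s ++ [seq H (x, y) | x <- s, y <- s]); split.
  move=> b; rewrite mem_cat => /orP[/mapP[a _ ->]|/allpairsP[[x y] [_ _ ->]]].
    exact: (GP a).1.
  exact: (HP _).1.
move=> C' C'P.
have GC a : a \in s -> (lower C1 a -> lower C' a) /\ (~ lower C2 a -> ~ lower C' a).
  by move=> sa; apply: (GP a).2; apply: C'P; rewrite mem_cat map_f.
have HC x y : x \in s -> y \in s -> B x -> B y -> lower C' x -> lower C' y.
  move=> sx sy; apply: (HP (x, y)).2; apply: C'P.
  by rewrite mem_cat; apply/orP; right; apply/allpairsP; exists (x, y).
(* If one point of s in B is below C', all are, and C' looks like the upper edge on s; otherwise it
   looks like the lower edge. *)
have [[x [sx Bx C'x]]|nx] := pselect (exists x, [/\ x \in s, B x & lower C' x]).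
  apply: sU2 => a sa; have {}sa : a \in s by rewrite mem_cat sa orbT.
  split=> [C2a|C'a]; last by apply: contrapT => /(GC _ sa).2.
  have [C1a|C1a] := pselect (lower C1 a); first exact: (GC _ sa).1.
  by apply: HC sx sa Bx _ C'x; apply/(between_edges _ HB e1 e2).
apply: sU1 => a sa; have {}sa : a \in s by rewrite mem_cat sa.
split=> [|C'a]; first exact: (GC _ sa).1.
apply: contrapT => C1a; apply: nx; exists a; split=> //.
apply/(between_edges _ HB e1 e2); split=> //.
by apply: contrapT => /(GC _ sa).2.
Qed.

Lemma Mset_place (z : ratfun K -> option RR) :
  Mset (ratfun K) z <-> exists C, z = cut_place C.
Proof. by split=> [/place_cut//|[C ->]]; exact: cut_placeP. Qed.

Lemma place_image_open (U : set (cut K)) : full_open U ->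
  Mopen [set z | exists2 C, U C & z = cut_place C].
Proof.
move=> oU; split=> [_ [C _ ->]|_ [C UC ->]]; first exact: cut_placeP.
have [bs [bs1 bs2]] := full_open_nbhd oU UC; exists bs; split.
  by move=> b /bs1; exact: (Hp_cut_place _ _).2.
move=> _ /Mset_place[C' ->] C'P; exists C' => //.
by apply: bs2 => b /C'P/Hp_cut_place.
Qed.

Lemma place_preimage_open (U : set (ratfun K -> option RR)) : Mopen U ->
  full_open [set C | U (cut_place C)].
Proof.
move=> [_ oU]; split=> [C1 C2 /= UC /cut_equiv_place <-//|].
apply/interval_openP => C UC; have [bs [bs1 bs2]] := oU _ UC.
have {}bs1 b : b \in bs -> unit_pos (pos C) b by move=> /bs1/Hp_cut_place.
have [s sP] : exists s, forall C', agree s C C' ->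
    forall b, b \in bs -> unit_pos (pos C') b.
  elim: bs bs1 {bs2} => [|b bs IH] bsC; first by exists [::].
  have [|s sP] := IH; first by move=> b' b's; apply: bsC; rewrite inE b's orbT.
  have [s' s'P] := unit_pos_agree (bsC b (mem_head _ _)).
  exists (s' ++ s) => C' /agree_cat[/s'P Cb /sP Cbs] b'.
  by rewrite inE => /orP[/eqP ->|/Cbs].
exists s => C' /sP C'P; apply: bs2; first exact: cut_placeP.
by move=> b /C'P; exact: (Hp_cut_place _ _).2.
Qed.

End FullTopology.

(** * Pulling rational functions, cuts and places back from F to R *)

Section Restriction.
Variables (R F : rcfType) (f : {rmorphism R -> F}).

Lemma rcf_rmorph_le x y : (f x <= f y) = (x <= y).
Proof.
have H u v : u <= v -> f u <= f v.
  move=> uv; rewrite -subr_ge0 -rmorphB -[v - u]sqr_sqrtr ?subr_ge0 //.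
  by rewrite rmorphXn sqr_ge0.
have [/H //|yx] := leP x y; apply/negP => fxy.
have /H fyx := ltW yx; have /fmorph_inj xy : f x = f y by apply: le_anti; rewrite fxy.
by rewrite xy ltxx in yx.
Qed.

Lemma rcf_rmorph_lt x y : (f x < f y) = (x < y).
Proof. by rewrite !ltNge rcf_rmorph_le. Qed.

Lemma rcf_rmorph_norm x : f `|x| = `|f x|.
Proof.
have [x0|/ltW x0] := leP 0 x; first by rewrite !ger0_norm // -(rmorph0 f) rcf_rmorph_le.
by rewrite !ler0_norm ?rmorphN // -(rmorph0 f) rcf_rmorph_le.
Qed.

Lemma ext_frac (p q : {poly R}) : q != 0 ->
  ext_ratfun f (polyfrac p / polyfrac q) =
  polyfrac (map_poly f p) / polyfrac (map_poly f q).
Proof.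
move=> q0; have := repr_frac p q0; rewrite /ext_ratfun.
have: \d_(repr (polyfrac p / polyfrac q)) != 0 by rewrite denom_ratioP.
move: (\n_ _) (\d_ _) => n d d0 pdnq.
apply/eqP; rewrite eqr_div ?tofrac_eq0 ?map_poly_eq0 //.
by rewrite /polyfrac -!tofracM tofrac_eq -!rmorphM -pdnq.
Qed.

Lemma ext_poly (p : {poly R}) :
  ext_ratfun f (polyfrac p) = polyfrac (map_poly f p).
Proof.
have := ext_frac p (oner_neq0 _).
by rewrite [map_poly f 1]rmorph1 /polyfrac !tofrac1 !divr1.
Qed.

Lemma extD g h : ext_ratfun f (g + h) = ext_ratfun f g + ext_ratfun f h.
Proof.
elim/ratfun_ind: g => p q q0; elim/ratfun_ind: h => p' q' q'0.
rewrite addf_div ?tofrac_eq0 // /polyfrac -!tofracM -tofracD -!/(polyfrac _).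
rewrite !ext_frac ?mulf_neq0 // addf_div ?tofrac_eq0 ?map_poly_eq0 //.
by rewrite /polyfrac -!tofracM -tofracD -!rmorphM -rmorphD.
Qed.

Lemma extM g h : ext_ratfun f (g * h) = ext_ratfun f g * ext_ratfun f h.
Proof.
elim/ratfun_ind: g => p q q0; elim/ratfun_ind: h => p' q' q'0.
rewrite mulf_div /polyfrac -!tofracM -!/(polyfrac _).
by rewrite !ext_frac ?mulf_neq0 // mulf_div /polyfrac -!tofracM -!rmorphM.
Qed.

Lemma ext_const c : ext_ratfun f (ratconst c) = ratconst (f c).
Proof. by rewrite /ratconst ext_poly map_polyC. Qed.

Lemma extN g : ext_ratfun f (- g) = - ext_ratfun f g.
Proof.
have E (K : fieldType) : -1 = ratconst (-1) :> ratfun K.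
  by rewrite /ratconst /polyfrac polyCN tofracN polyC1 tofrac1.
by rewrite -mulN1r E extM ext_const rmorphN1 -E mulN1r.
Qed.

Lemma ext0_eq0 g : ext_ratfun f g = 0 -> g = 0.
Proof.
elim/ratfun_ind: g => p q q0; rewrite ext_frac // => /eqP.
rewrite mulf_eq0 invr_eq0 !tofrac_eq0 !map_poly_eq0 (negPf q0) orbF => /eqP ->.
by rewrite /polyfrac tofrac0 mul0r.
Qed.

Fact cut_res_initial (C : cut F) : is_initial (cut_res f C).
Proof. by move=> x y xy; apply: lower_le; rewrite rcf_rmorph_le. Qed.
Definition restrict_cut (C : cut F) : cut R := exist _ _ (@cut_res_initial C).

(** The pullback of an ordering is an ordering with the restricted cut, so uniqueness applies and
    neighbourhoods in R and in F need not be compared. *)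
Lemma pos_restrict (C : cut F) :
  [set g | pos C (ext_ratfun f g)] = pos (restrict_cut C).
Proof.
have [PD [PM [PT PA]]] := pos_ordering C.
apply: ordering_unique.
  split=> [g h|]; last split=> [g h|]; last split=> [g|g]; rewrite /= ?extD ?extM ?extN.
  - exact: PD.
  - exact: PM.
  - exact: PT.
  - by move=> h1 h2; apply: ext0_eq0; exact: PA.
apply/seteqP; split=> d /=; rewrite /cut_res /= extD extN ext_const;
  rewrite /ratvar ext_poly map_polyX -/(ratvar F).
  by rewrite {1}lower_pos.
by move=> ?; rewrite lower_pos.
Qed.

Lemma ext_rat q : ext_ratfun f (ratr q) = ratr q.
Proof.
have ext_nat n : ext_ratfun f n%:R = n%:R by rewrite !ratconst_nat ext_const rmorph_nat.
have ext_int m : ext_ratfun f m%:~R = m%:~R.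
  case: m => n; first exact: ext_nat.
  by rewrite NegzE !mulrNz extN; congr (- _); exact: ext_nat.
have n0 (K : rcfType) n : n.+1%:R != 0 :> ratfun K.
  by rewrite ratconst_nat tofrac_eq0 polyC_eq0 pnatr_eq0.
have d0 (K : rcfType) : (denq q)%:~R != 0 :> ratfun K.
  by rewrite -absz_denq -(prednK (_ : 0 < `|denq q|)%N) ?absz_gt0 ?denq_eq0 //; exact: n0.
have E (K : rcfType) : ratr q * (denq q)%:~R = (numq q)%:~R :> ratfun K.
  by rewrite /ratr divfK //; exact: d0.
by apply: (mulIf (d0 F)); rewrite E -[in LHS]ext_int -extM E ext_int.
Qed.

Lemma res_place (C : cut F) : res f (cut_place C) = cut_place (restrict_cut C).
Proof.
have P g : pos C (ext_ratfun f g) = pos (restrict_cut C) g by rewrite -pos_restrict.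
have ext_nat n : ext_ratfun f n%:R = n%:R by rewrite !ratconst_nat ext_const rmorph_nat.
apply/funext => g; rewrite /res /cut_place /lam.
have -> : (fun n : nat => pos C (n%:R - ext_ratfun f g) /\ pos C (ext_ratfun f g + n%:R))
  = (fun n : nat => pos (restrict_cut C) (n%:R - g) /\ pos (restrict_cut C) (g + n%:R)).
  by apply/funext => n; rewrite -!P !extD extN ext_nat.
have -> // : (fun r : RR => exists q : rat, r = ratr q /\ pos C (ext_ratfun f g - ratr q))
  = (fun r : RR => exists q : rat, r = ratr q /\ pos (restrict_cut C) (g - ratr q)).
by apply/funext => r; congr (ex _); apply/funext => q; rewrite -P extD extN ext_rat.
Qed.

End Restriction.

(** * Extending places when vR is convex in vF *)

Section Extension.
Variables (R F : rcfType) (f : {rmorphism R -> F}).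
Implicit Types (A : set R) (C : cut R).

Fact plus_cut_initial A : is_initial [set x : F | exists a, A a /\ x <= f a].
Proof. by move=> x y xy [a [Aa ya]]; exists a; split=> //; exact: le_trans ya. Qed.
Definition plus_cut A : cut F := exist _ _ (@plus_cut_initial A).

Fact minus_cut_initial A : is_initial [set x : F | forall a, A a -> x < f a].
Proof. by move=> x y xy yA a /yA; exact: le_lt_trans. Qed.
Definition minus_cut A : cut F := exist _ _ (@minus_cut_initial A).

Lemma is_plus_inP A (C' : cut F) : is_plus_in f A C' <-> C' = plus_cut A.
Proof. by split=> [?|-> //]; exact: cut_eq. Qed.

Lemma is_minus_inP A (C' : cut F) : is_minus_in f A C' <-> C' = minus_cut A.
Proof. by split=> [?|-> //]; exact: cut_eq. Qed.

(** Nonemptiness is included, so that this says that C is a limit of smaller cuts. *)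
Definition no_max C := (exists d, lower C d) /\
  forall d, lower C d -> exists2 d', lower C d' & d < d'.

Definition no_min C := (exists e, ~ lower C e) /\
  forall e, ~ lower C e -> exists2 e', ~ lower C e' & e' < e.

Lemma no_max_or_no_min C : no_max C \/ no_min C.
Proof.
have [[e Ce]|nE] := pselect (exists e, ~ lower C e); last first.
  have CT x : lower C x by apply: contrapT => Cx; apply: nE; exists x.
  by left; split; [exists 0|move=> d _; exists (d + 1) => //; lra].
have [[d Cd]|nD] := pselect (exists d, lower C d); last first.
  have CT x : ~ lower C x by move=> Cx; apply: nD; exists x.
  by right; split; [exists e|move=> x _; exists (x - 1) => //; lra].
have [[m Cm mP]|h] := pselect (exists2 m, lower C m & forall d, lower C d -> d <= m).
  right; split; first by exists e.
  move=> x Cx; have mx := lower_lt Cm Cx; exists ((m + x) / 2); last by lra.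
  by move=> /mP; lra.
left; split; first by exists d.
move=> x Cx; apply: contrapT => hx; apply: h; exists x => // y Cy.
by rewrite leNgt; apply/negP => xy; apply: hx; exists y.
Qed.

Section Convex.
Hypothesis vcf : vconvex f.

(** This is how convexity enters: a positive b bounded by R either has its value in vR or is
    infinitesimal over R. *)
Lemma vconvex_scale (b : F) (s : R) : 0 < b -> b < f s ->
  (exists r (m : nat), [/\ 0 < r, f r <= b & b <= m%:R * f r]) \/
  (forall r, 0 < r -> b < f r).
Proof.
move=> b0 bs; have [[r r0 rb]|h] := pselect (exists2 r, 0 < r & f r <= b); last first.
  by right=> r r0; rewrite ltNge; apply/negP => rb; apply: h; exists r.
have f0 x : 0 < x -> 0 < f x by move=> x0; rewrite -(rmorph0 f) rcf_rmorph_lt.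
have s0 : 0 < s by rewrite -(rcf_rmorph_lt f) rmorph0; apply: lt_trans bs.
left; have [||||c [c0 [[n cn] [m mc]]]] := @vcf b s r _ _ (lt0r_neq0 b0); rewrite ?lt0r_neq0 //.
- by exists 1%N; rewrite mul1r !gtr0_norm ?f0 // ltW.
- by exists 1%N; rewrite mul1r !gtr0_norm ?f0.
rewrite (gtr0_norm b0) in cn mc.
have c1 : 0 < `|f c| by rewrite normr_gt0 fmorph_eq0.
case: n cn => [|n] cn; first by move: c1; rewrite mul0r in cn; rewrite ltNge cn.
have n0 : 0 < n.+1%:R :> F by rewrite ltr0n.
exists (`|c| / n.+1%:R), (m * n.+1)%N; rewrite fmorph_div rmorph_nat rcf_rmorph_norm; split.
- by rewrite divr_gt0 ?normr_gt0 ?ltr0n.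
- by rewrite ler_pdivrMr // mulrC.
- by rewrite natrM -mulrA [n.+1%:R * _]mulrC divfK ?lt0r_neq0.
Qed.

(* The last hypothesis holds both for a single cut [C1 = C2] and for the two edges
   of a ball. A pair x, y in the gap over F whose reflection leaves it has a
   distance comparable to some r in R, or smaller than all of them, by convexity
   of vR; the first contradicts this hypothesis, the second [no_max] or [no_min]. *)
Lemma shift_equiv C1 C2 :
  no_max C1 -> no_min C2 -> (forall x, lower C1 x -> lower C2 x) ->
  (forall r, 0 < r -> (forall d e, lower C1 d -> ~ lower C2 e -> d + r < e) ->
     (forall d, lower C1 d -> lower C1 (d + r)) /\
     (forall e, ~ lower C2 e -> ~ lower C2 (e - r))) ->
  cut_equiv (plus_cut (lower C1)) (minus_cut (upper C2)).
Proof.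
move=> [[d0 C1d0] nmax] [[e0 C2e0] nmin] sub shift.
set C1' := plus_cut _; set C2' := minus_cut _.
have sub' x : lower C1' x -> lower C2' x.
  move=> [d [/sub C2d xd]] e C2e; apply: le_lt_trans xd _.
  by rewrite rcf_rmorph_lt; exact: lower_lt C2e.
have [->|n] := pselect (C1' = C2'); first by left.
have C1P x : ~ lower C1' x -> forall d, lower C1 d -> f d < x.
  by move=> C1x d C1d; rewrite ltNge; apply/negP => xd; apply: C1x; exists d.
have C2P x : lower C2' x -> forall e, ~ lower C2 e -> x < f e.
  by move=> C2x e; exact: C2x.
have [//|B HB [h1 h2]] := edges_of_reflect sub' n _; last exact: edges_equiv h1 h2.
move=> x y /C1P C1x /C2P C2x /C1P C1y /C2P C2y.
split.
  move=> [d [C1d xyd]]; have xd := C1x _ C1d.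
  have b0 : 0 < y - x by lra.
  have bs : y - x < f (e0 - d0).
    by rewrite rmorphB; have := C2y _ C2e0; have := C1x _ C1d0; lra.
  have [[r [m [r0 rb bm]]]|small] := vconvex_scale b0 bs.
    have [|S _] := shift r r0.
      move=> d' e' C1d' C2e'; rewrite -(rcf_rmorph_lt f) rmorphD.
      by have := C2y _ C2e'; have := C1x _ C1d'; lra.
    have Sn k : lower C1 (d + k%:R * r).
      elim: k => [|k IH]; first by rewrite mul0r addr0.
      by rewrite -natr1 mulrDl mul1r addrA; exact: S.
    have := C1x _ (Sn m); rewrite rmorphD rmorphM rmorph_nat.
    by move: bm; set u := m%:R * _; lra.
  have [d' C1d' dd'] := nmax _ C1d.
  have := small (d' - d); rewrite subr_gt0 rmorphB => /(_ dd').
  by have := C1x _ C1d'; lra.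
move=> e C2e; rewrite ltNge; apply/negP => xye; have xe := C2x _ C2e.
have b0 : 0 < x - y by lra.
have bs : x - y < f (e0 - d0).
  by rewrite rmorphB; have := C2x _ C2e0; have := C1y _ C1d0; lra.
have [[r [m [r0 rb bm]]]|small] := vconvex_scale b0 bs.
  have [|_ S] := shift r r0.
    move=> d' e' C1d' C2e'; rewrite -(rcf_rmorph_lt f) rmorphD.
    by have := C2x _ C2e'; have := C1y _ C1d'; lra.
  have Sn k : ~ lower C2 (e - k%:R * r).
    elim: k => [|k IH]; first by rewrite mul0r subr0.
    by rewrite -natr1 mulrDl mul1r opprD addrA; exact: S.
  have := C2x _ (Sn m); rewrite rmorphB rmorphM rmorph_nat.
  by move: bm; set u := m%:R * _; lra.
have [e' C2e' ee'] := nmin _ C2e.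
have := small (e - e'); rewrite subr_gt0 rmorphB => /(_ ee').
by have := C2x _ C2e'; lra.
Qed.

Lemma gap_equiv C : no_max C -> no_min C ->
  cut_equiv (plus_cut (lower C)) (minus_cut (upper C)).
Proof.
move=> nmax nmin; apply: shift_equiv => //.
move=> r r0 h; split=> [d Cd|e Ce].
  by apply: contrapT => /(h _ _ Cd); rewrite ltxx.
by move=> /h/(_ Ce); rewrite subrK ltxx.
Qed.

Lemma ball_mid_notin (B : set R) c x : is_ball B -> B c -> ~ B x -> ~ B ((x + c) / 2).
Proof.
move=> HB Bc Bx Bm; apply: Bx; have := ball_reflect HB Bm Bc.
by congr B; field.
Qed.

Lemma notin_ball (B : set R) C1 C2 c x : is_ball B -> lower_edge B C1 ->
  upper_edge B C2 -> B c -> ~ B x -> (x < c -> lower C1 x) /\ (c < x -> ~ lower C2 x).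
Proof.
move=> HB e1 e2 Bc Bx; have C1c := lower_edge_ball HB e1 Bc.
have C2c := upper_edge_ball e2 Bc.
split=> [xc|cx C2x].
  apply: contrapT => C1x; apply: Bx; apply/(between_edges _ HB e1 e2).
  by split=> //; apply: lower_le C2c; exact: ltW.
apply: Bx; apply/(between_edges _ HB e1 e2); split=> // C1x.
by apply: C1c; apply: lower_le C1x; exact: ltW.
Qed.

Lemma proper_ball_notin (B : set R) c : is_ball B -> B <> setT -> B c ->
  exists x y, [/\ ~ B x, ~ B y & x < c < y].
Proof.
move=> HB nT Bc; have [z Bz] : exists z, ~ B z.
  apply: contrapT => h; apply: nT; apply/seteqP; split=> // x _.
  by apply: contrapT => Bx; apply: h; exists x.
have Bz' : ~ B (2 * c - z).
  by move=> Bz'; apply: Bz; have := ball_reflect HB Bc Bz'; congr B; ring.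
have [zc|cz|zc] := ltrgtP z c; last by rewrite zc in Bz.
  by exists z, (2 * c - z); split=> //; lra.
by exists (2 * c - z), z; split=> //; lra.
Qed.

Lemma lower_edge_no_max (B : set R) C : is_ball B -> B <> setT ->
  lower_edge B C -> no_max C.
Proof.
move=> HB nT e1; have [c Bc] := ball_nonempty HB; have [C2 e2] := upper_edge_ex B.
have [x [_ [Bx _ /andP[xc _]]]] := proper_ball_notin HB nT Bc.
split=> [|d Cd].
  by exists x; apply: (notin_ball HB e1 e2 Bc Bx).1.
have dc : d < c := lower_lt Cd (lower_edge_ball HB e1 Bc).
have Bd : ~ B d by move=> Bd; apply: (lower_edge_ball HB e1 Bd).
exists ((d + c) / 2); last by lra.
by apply: (notin_ball HB e1 e2 Bc (ball_mid_notin HB Bc Bd)).1; lra.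
Qed.

Lemma upper_edge_no_min (B : set R) C : is_ball B -> B <> setT ->
  upper_edge B C -> no_min C.
Proof.
move=> HB nT e2; have [c Bc] := ball_nonempty HB; have [C1 e1] := lower_edge_ex B.
have [_ [y [_ By /andP[_ cy]]]] := proper_ball_notin HB nT Bc.
split=> [|d Cd].
  by exists y; apply: (notin_ball HB e1 e2 Bc By).2.
have dc : c < d := lower_lt (upper_edge_ball e2 Bc) Cd.
have Bd : ~ B d by move=> Bd; apply: Cd; exact: upper_edge_ball Bd.
exists ((d + c) / 2); last by lra.
by apply: (notin_ball HB e1 e2 Bc (ball_mid_notin HB Bc Bd)).2; lra.
Qed.

Lemma ball_equiv (B : set R) C1 C2 : is_ball B -> B <> setT ->
  lower_edge B C1 -> upper_edge B C2 ->
  cut_equiv (plus_cut (lower C1)) (minus_cut (upper C2)).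
Proof.
move=> HB nT e1 e2; have [c Bc] := ball_nonempty HB.
apply: shift_equiv; [exact: lower_edge_no_max e1|exact: upper_edge_no_min e2|..].
  by move=> x; exact: (edges_sub HB e1 e2).
move=> r r0 h.
have sc x : B x -> B (c + r) -> B (x + r) /\ B (x - r).
  move=> Bx Bcr; split; apply: (ball_shift (x := c + r) (y := c) (n := 1)) => //;
    by rewrite ?normrN mul1r addrAC subrr add0r.
have Bcr : B (c + r).
  apply: contrapT => Bcr.
  (* If r is not a radius of B, neither is r/3; then c - r/3 and c + r/3 are on the outer sides of B
     at distance 2r/3 < r. *)
  have B1 : ~ B (c + r / 3).
    move=> B1; apply: Bcr; apply: (ball_shift (x := c + r / 3) (y := c) (n := 3)) => //.
    rewrite addrAC subrr add0r !gtr0_norm //; lra.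
  have B2 : ~ B (c - r / 3).
    move=> B2; apply: Bcr; apply: (ball_shift (x := c) (y := c - r / 3) (n := 3)) => //.
    rewrite opprB addrC subrK !gtr0_norm //; lra.
  have := h _ _ ((notin_ball HB e1 e2 Bc B2).1 _) ((notin_ball HB e1 e2 Bc B1).2 _).
  by move=> /(_ ltac:(lra) ltac:(lra)); lra.
split=> [d C1d|e C2e].
  apply: contrapT => C1dr; have [b Bb bd] : exists2 b, B b & b <= d + r.
    apply: contrapT => hb; apply: C1dr; apply/(lower_edgeP e1) => b Bb.
    by rewrite ltNge; apply/negP => bd; apply: hb; exists b.
  apply: (lower_edge_ball HB e1 (sc _ Bb Bcr).2).
  by apply: lower_le C1d; rewrite lerBlDr.
move=> /(upper_edgeP e2)[b Bb eb]; apply: C2e; apply/(upper_edgeP e2).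
by exists (b + r); [exact: (sc _ Bb Bcr).1|rewrite -lerBlDr].
Qed.

End Convex.

(** The gap is the convex hull of R in F, which is closed under reflection because R is. *)
Lemma hull_equiv : cut_equiv (minus_cut setT) (plus_cut setT).
Proof.
set C1 := minus_cut _; set C2 := plus_cut _.
have P1 x : ~ lower C1 x -> exists r, f r <= x.
  move=> C1x; apply: contrapT => h; apply: C1x => r _.
  by rewrite ltNge; apply/negP => rx; apply: h; exists r.
have sub x : lower C1 x -> lower C2 x by move=> /(_ 0 I) x0; exists 0; split=> //; exact: ltW.
have [->|n] := pselect (C1 = C2); first by left.
have [//|B HB [h1 h2]] := edges_of_reflect sub n _; last exact: edges_equiv h1 h2.
move=> x y /P1[r1 r1x] [r2 [_ xr2]] /P1[s1 s1y] [s2 [_ ys2]]; split.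
  move=> /(_ (2 * r1 - s2) I); rewrite rmorphB rmorphM rmorph_nat; lra.
by exists (2 * r2 - s1); split=> //; rewrite rmorphB rmorphM rmorph_nat; lra.
Qed.

Lemma ball_setT (K : rcfType) : is_ball [set: K].
Proof. by apply: ball_of_reflect => //; exists 0. Qed.

Lemma ball_set1 (K : rcfType) (a : K) : is_ball [set a].
Proof.
apply: ball_of_reflect => [|x y z -> ->|x y -> ->]; first by exists a.
  by move=> az; apply: le_anti; rewrite andbC.
by rewrite /=; ring.
Qed.

Lemma ball_cutP C : ball_cut C <-> exists2 B, is_ball B & is_edge B C.
Proof.
split=> [[B [HB [e|e]]]|[B HB [e|e]]]; exists B => //; [by right|by left| |].
  by split=> //; right.
by split=> //; left.
Qed.

(** The extreme balls account for this: an empty lower set makes C the lower edge of R, a maximum d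
    makes it the upper edge of {d}. *)
Lemma not_ball_cut_no_max C : ~ ball_cut C -> no_max C.
Proof.
move=> nC; split=> [|d Cd].
  apply: contrapT => h; apply: nC; apply/ball_cutP; exists setT; first exact: ball_setT.
  left; apply/seteqP; split=> x; first by move=> Cx; case: h; exists x.
  by move=> /(_ x I); rewrite ltxx.
apply: contrapT => h; apply: nC; apply/ball_cutP; exists [set d]; first exact: ball_set1.
right; apply/seteqP; split=> [x Cx|x [_ [-> xd]]]; last exact: lower_le Cd.
by exists d; split=> //; rewrite leNgt; apply/negP => dx; apply: h; exists x.
Qed.

Lemma not_ball_cut_no_min C : ~ ball_cut C -> no_min C.
Proof.
move=> nC; split=> [|d Cd].
  apply: contrapT => h; apply: nC; apply/ball_cutP; exists setT; first exact: ball_setT.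
  right; apply/seteqP; split=> x; first by exists x.
  by move=> _; apply: contrapT => Cx; apply: h; exists x.
apply: contrapT => h; apply: nC; apply/ball_cutP; exists [set d]; first exact: ball_set1.
left; apply/seteqP; split=> [x Cx _ ->|x xd]; first exact: lower_lt Cd.
by apply: contrapT => Cx; apply: h; exists x => //; exact: xd.
Qed.

(** The prescriptions are compatible: a cut is not both an upper and a lower edge, and the two
    trivial cuts are not edges of proper balls. *)
Lemma admissible_ex : exists t, admissible f t.
Proof.
have key C : exists C' : cut F, [/\
  ~ ball_cut C -> is_plus_in f (lower C) C' \/ is_minus_in f (upper C) C',
  forall B, is_ball B -> B <> setT -> lower_edge B C -> is_plus_in f (lower C) C',
  forall B, is_ball B -> B <> setT -> upper_edge B C -> is_minus_in f (upper C) C',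
  lower C = set0 -> is_minus_in f setT C' & lower C = setT -> is_plus_in f setT C'].
  have [[B [HB nT e]]|nu] := pselect (exists B, [/\ is_ball B, B <> setT & upper_edge B C]).
    exists (minus_cut (upper C)); split=> [_|B' HB' _ e'|//|C0|CT]; first by right.
    - by case: (@edges_disjoint _ C); [exists B|exists B'].
    - by rewrite /upper C0 setC0.
    - have [[y Cy] _] := upper_edge_no_min HB nT e.
      by case: Cy; rewrite CT.
  have [C0|C0] := pselect (lower C = set0).
    exists (minus_cut setT); split=> [_|B HB nT e|B HB nT e|//|CT].
    - by right; rewrite /upper C0 setC0.
    - have [[y Cy] _] := lower_edge_no_max HB nT e.
      by rewrite C0 in Cy.
    - by case: nu; exists B.
    - by have : [set: R] 0 by []; rewrite -CT C0.
  exists (plus_cut (lower C)); split=> [_|//|B HB nT e|//|CT]; first by left.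
    by case: nu; exists B.
  by rewrite CT.
have /choice[t tP] := key; exists t; split; last split; last split; last split.
- by move=> C; case: (tP C).
- by move=> C B HB nT; case: (tP C) => _ /(_ B HB nT).
- by move=> C B HB nT; case: (tP C) => _ _ /(_ B HB nT).
- by move=> C; case: (tP C).
- by move=> C; case: (tP C).
Qed.

(** * Images under an admissible map, up to equivalence *)

Section Admissible.
Variables (t : cut R -> cut F) (tP : admissible f t).

Lemma admissible_cases C : t C = plus_cut (lower C) \/ t C = minus_cut (upper C).
Proof.
have [t1 [t2 [t3 [t4 t5]]]] := tP.
have [/ball_cutP[B HB e]|nC] := pselect (ball_cut C); last first.
  by have [/is_plus_inP|/is_minus_inP] := t1 _ nC; [left|right].
have [BT|nT] := pselect (B = setT); last first.
  by case: e => e; [left; exact/is_plus_inP/(t2 _ B)|right; exact/is_minus_inP/(t3 _ B)].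
case: e => e; [right; apply/is_minus_inP|left; apply/is_plus_inP].
  have C0 : lower C = set0.
    apply/seteqP; split=> // x /(lower_edgeP e)/(_ x); rewrite BT => /(_ I).
    by rewrite ltxx.
  by rewrite /upper C0 setC0; exact: t4.
have CT : lower C = setT.
  by apply/seteqP; split=> // x _; apply/(upper_edgeP e); exists x; rewrite ?BT.
by rewrite CT; exact: t5.
Qed.

Lemma admissible_restrict C : restrict_cut f (t C) = C.
Proof.
apply: cut_ext => x; rewrite /= /cut_res.
case: (admissible_cases C) => -> /=.
  split=> [[d [Cd]]|Cx]; first by rewrite rcf_rmorph_le => /lower_le; apply.
  by exists x.
split=> [h|Cx e Ce]; last by rewrite rcf_rmorph_lt; exact: lower_lt Ce.
by apply: contrapT => /h; rewrite ltxx.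
Qed.

Hypothesis vcf : vconvex f.

(** If C is a limit of smaller cuts, D^+ represents its image whichever clause applies: where the
    clause gives E^-, the gap over F is a ball by [gap_equiv]. *)
Lemma admissible_plus C : no_max C -> cut_equiv (t C) (plus_cut (lower C)).
Proof.
move=> nmax; have [t1 [t2 [t3 [t4 t5]]]] := tP.
have [/ball_cutP[B HB e]|nC] := pselect (ball_cut C); last first.
  have := gap_equiv vcf nmax (not_ball_cut_no_min nC).
  have [/is_plus_inP ->|/is_minus_inP ->] := t1 _ nC; first by left.
  exact: cut_equiv_sym.
have [BT|nT] := pselect (B = setT).
  case: e => e.
    have [[d Cd] _] := nmax; move/(lower_edgeP e)/(_ d): Cd; rewrite BT => /(_ I).
    by rewrite ltxx.
  have CT : lower C = setT.
    by apply/seteqP; split=> // x _; apply/(upper_edgeP e); exists x; rewrite ?BT.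
  by left; rewrite CT; apply/is_plus_inP/t5.
case: e => e; first by left; exact/is_plus_inP/(t2 _ B).
have /is_minus_inP -> := t3 _ _ HB nT e.
exact/cut_equiv_sym/gap_equiv/(upper_edge_no_min HB).
Qed.

Lemma admissible_minus C : no_min C -> cut_equiv (t C) (minus_cut (upper C)).
Proof.
move=> nmin; have [t1 [t2 [t3 [t4 t5]]]] := tP.
have [/ball_cutP[B HB e]|nC] := pselect (ball_cut C); last first.
  have := gap_equiv vcf (not_ball_cut_no_max nC) nmin.
  by have [/is_plus_inP ->|/is_minus_inP ->] := t1 _ nC; last by left.
have [BT|nT] := pselect (B = setT).
  case: e => e; last first.
    by have [[d Cd] _] := nmin; case: Cd; apply/(upper_edgeP e); exists d; rewrite ?BT.
  have C0 : lower C = set0.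
    apply/seteqP; split=> // x /(lower_edgeP e)/(_ x); rewrite BT => /(_ I).
    by rewrite ltxx.
  by left; rewrite /upper C0 setC0; apply/is_minus_inP/t4.
case: e => e; last by left; exact/is_minus_inP/(t3 _ B).
have /is_plus_inP -> := t2 _ _ HB nT e.
exact/gap_equiv/nmin/(lower_edge_no_max HB).
Qed.

End Admissible.

Lemma admissible_edges t t' B C1 C2 : vconvex f -> admissible f t -> admissible f t' ->
  is_ball B -> lower_edge B C1 -> upper_edge B C2 -> cut_equiv (t C1) (t' C2).
Proof.
move=> vcf [_ [t2 [_ [t4 _]]]] [_ [_ [t3' [_ t5']]]] HB e1 e2.
have [BT|nT] := pselect (B = setT); last first.
  have /is_plus_inP -> := t2 _ _ HB nT e1; have /is_minus_inP -> := t3' _ _ HB nT e2.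
  exact: ball_equiv e1 e2.
have C0 : lower C1 = set0.
  apply/seteqP; split=> // x /(lower_edgeP e1)/(_ x); rewrite BT => /(_ I).
  by rewrite ltxx.
have CT : lower C2 = setT.
  by apply/seteqP; split=> // x _; apply/(upper_edgeP e2); exists x; rewrite ?BT.
have /is_minus_inP -> := t4 _ C0; have /is_plus_inP -> := t5' _ CT.
exact: hull_equiv.
Qed.

(** Allowing two maps at once gives both that the map on places is well defined and that it is
    independent of the choice. *)
Lemma admissible_place t t' C1 C2 : vconvex f -> admissible f t -> admissible f t' ->
  cut_place C1 = cut_place C2 -> cut_place (t C1) = cut_place (t' C2).
Proof.
move=> vcf tP tP' /cut_equiv_place/cut_equivP[<-|[B HB [[e1 e2]|[e2 e1]]]].
- have [nm|nm] := no_max_or_no_min C1.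
    have /cut_equiv_place -> := admissible_plus tP vcf nm.
    by have /cut_equiv_place -> := admissible_plus tP' vcf nm.
  have /cut_equiv_place -> := admissible_minus tP vcf nm.
  by have /cut_equiv_place -> := admissible_minus tP' vcf nm.
- exact/cut_equiv_place/(admissible_edges vcf tP tP' HB).
- exact/esym/cut_equiv_place/(admissible_edges vcf tP' tP HB).
Qed.

(* Cuts C' slightly below C are sent close to D^+ and cuts slightly above C close
   to E^-; both are equivalent to the image of C unless C has no cuts arbitrarily
   close to it on that side. *)
Lemma admissible_continuous t : vconvex f -> admissible f t -> full_continuous t.
Proof.
move=> vcf tP V [fV /interval_openP oV]; split=> [C1 C2 /= VC1 C12|].
  apply: fV VC1 _; apply/cut_equiv_place/admissible_place => //.
  exact/cut_equiv_place.
have tres C x : lower (t C) (f x) <-> lower C x.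
  by rewrite -{2}(admissible_restrict tP C).
apply/interval_openP => C VC.
have [s1 s1P] : exists s, forall C', agree s C C' ->
    (forall x, lower C' x -> lower C x) -> V (t C').
  have [nm|nm] := pselect (no_max C); last first.
    have [[d Cd]|h] := pselect (exists d, lower C d); last first.
      exists [::] => C' _ sub; have -> // : C' = C.
      by apply: cut_ext => x; split=> [/sub//|Cx]; case: h; exists x.
    have [m Cm mP] : exists2 m, lower C m & forall x, lower C x -> x <= m.
      apply: contrapT => h; apply: nm; split; first by exists d.
      move=> x Cx; apply: contrapT => hx; apply: h; exists x => // y Cy.
      by rewrite leNgt; apply/negP => xy; apply: hx; exists y.
    exists [:: m] => C' /(_ m (mem_head _ _)) Cm' sub; have -> // : C' = C.
    apply: cut_ext => x; split=> [/sub//|/mP xm]; apply: lower_le xm _.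
    by apply/Cm'.
  have Vp : V (plus_cut (lower C)) := fV _ _ VC (admissible_plus tP vcf nm).
  have [s sP] := oV _ Vp.
  have /choice[g gP] : forall x : F, exists d, lower (plus_cut (lower C)) x ->
      lower C d /\ x <= f d.
    move=> x; have [[d dP]|h] := pselect (lower (plus_cut (lower C)) x).
      by exists d.
    by exists 0.
  exists (map g s) => C' CC' sub; have [<-//|/nesym n] := pselect (C = C').
  (* The witness d' bounds t C' from above by f d', so t C' cannot contain a point outside D^+. *)
  have [d' [C'd' Cd']] := lower_neq n sub.
  apply: sP => x sx; split=> [px|tx].
    have [Cd xd] := gP _ px; apply: lower_le xd _; apply/tres.
    by apply/(CC' (g x)); rewrite ?map_f.
  exists d'; split=> //; apply: ltW; apply: (lower_lt tx).
  by move=> /tres.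
have [s2 s2P] : exists s, forall C', agree s C C' ->
    (forall x, lower C x -> lower C' x) -> V (t C').
  have [nm|nm] := pselect (no_min C); last first.
    have [[d Cd]|h] := pselect (exists d, ~ lower C d); last first.
      exists [::] => C' _ sub; have -> // : C' = C.
      by apply: cut_ext => x; split=> [|/sub//] _; apply: contrapT => Cx; case: h; exists x.
    have [m Cm mP] : exists2 m, ~ lower C m & forall x, ~ lower C x -> m <= x.
      apply: contrapT => h; apply: nm; split; first by exists d.
      move=> x Cx; apply: contrapT => hx; apply: h; exists x => // y Cy.
      by rewrite leNgt; apply/negP => xy; apply: hx; exists y.
    exists [:: m] => C' /(_ m (mem_head _ _)) Cm' sub; have -> // : C' = C.
    apply: cut_ext => x; split=> [C'x|/sub//]; apply: contrapT => /mP mx.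
    by apply/Cm/Cm'/(lower_le mx).
  have Vp : V (minus_cut (upper C)) := fV _ _ VC (admissible_minus tP vcf nm).
  have [s sP] := oV _ Vp.
  have /choice[g gP] : forall x : F, exists e, ~ lower (minus_cut (upper C)) x ->
      ~ lower C e /\ f e <= x.
    move=> x; have [h|h] := pselect (exists e, ~ lower C e /\ f e <= x).
      by have [e eP] := h; exists e.
    exists 0 => hx; case: hx => e Ce; rewrite ltNge; apply/negP => ex.
    by apply: h; exists e.
  exists (map g s) => C' CC' sub; have [<-//|n] := pselect (C = C').
  have [d' [Cd' C'd']] := lower_neq n sub.
  apply: sP => x sx; split=> [px|tx].
    apply: lower_le (ltW (px d' Cd')) _; exact/tres.
  apply: contrapT => /gP[Ce ex]; apply: Ce; apply/(CC' (g x)); rewrite ?map_f //.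
  by apply/tres; apply: lower_le tx.
exists (s1 ++ s2) => C' /agree_cat[a1 a2].
by have [sub|sub] := lower_total C C'; [exact: s2P|exact: s1P].
Qed.

End Extension.

Lemma extend_places (R F : rcfType) (f : {rmorphism R -> F}) : vconvex f ->
  exists iota : (ratfun R -> option RR) -> (ratfun F -> option RR),
    [/\ forall t : cut R -> cut F, admissible f t ->
          forall C, iota (cut_place C) = cut_place (t C),
        Mcontinuous iota,
        forall z, Mset (ratfun R) z -> Mset (ratfun F) (iota z) &
        forall z, Mset (ratfun R) z -> res f (iota z) = z].
Proof.
move=> vcf; have [t0 t0P] := admissible_ex f.
have /choice[G GP] : forall z : ratfun R -> option RR, exists C,
    Mset (ratfun R) z -> z = cut_place C.
  move=> z; have [/Mset_place[C ->]|h] := pselect (Mset (ratfun R) z).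
    by exists C.
  (* An arbitrary cut: outside [Mset] nothing is required of the map. *)
  by exists (below 0) => /h.
pose iota z := cut_place (t0 (G z)).
have iotaE t : admissible f t -> forall C, iota (cut_place C) = cut_place (t C).
  move=> tP C; apply: (admissible_place (C1 := G _) (C2 := C) vcf t0P tP).
  exact/esym/GP/cut_placeP.
exists iota; split=> //.
- move=> U oU; have := place_image_open
    (admissible_continuous vcf t0P (place_preimage_open oU)).
  congr Mopen; apply/seteqP; split=> [_ [C /= UC ->]|z [/Mset_place[C ->] /= UC]].
    by split; [exact: cut_placeP|rewrite /= (iotaE _ t0P)].
  by exists C; rewrite //= -(iotaE _ t0P).
- by move=> z _; exact: cut_placeP.
- move=> _ /Mset_place[C ->]; rewrite (iotaE _ t0P) res_place.
  by rewrite (admissible_restrict t0P).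
Qed.

(** * Lifting a continuous extension to cuts *)

(** Passing to the other edge of the ball keeps the place; the new representative can be separated
    from the points below it. *)
Lemma not_upper_edge_rep (K : rcfType) (C : cut K) :
  exists2 C1, cut_place C1 = cut_place C & ~ is_upper_edge C1.
Proof.
have [[B HB e]|n] := pselect (is_upper_edge C); last by exists C.
have [C1 e1] := lower_edge_ex B; exists C1.
  by apply: (edge_place HB); [left|right].
by move=> /edges_disjoint; apply; exists B.
Qed.

Lemma not_lower_edge_rep (K : rcfType) (C : cut K) :
  exists2 C1, cut_place C1 = cut_place C & ~ is_lower_edge C1.
Proof.
have [[B HB e]|n] := pselect (is_lower_edge C); last by exists C.
have [C1 e1] := upper_edge_ex B; exists C1.
  by apply: (edge_place HB); [right|left].
by apply: edges_disjoint; exists B.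
Qed.

Lemma below_lower_edge (K : rcfType) (d : K) : lower_edge [set d] (below d).
Proof. by apply/seteqP; split=> [x xd _ ->|x xd]; [exact: xd|exact: xd]. Qed.

Lemma upto_upper_edge (K : rcfType) (d : K) : upper_edge [set d] (upto d).
Proof. by apply/seteqP; split=> [x xd|x [_ [-> xd]]] //; exists d. Qed.

Lemma principal_place (K : rcfType) (d : K) :
  cut_place (upto d) = cut_place (below d).
Proof.
apply: (edge_place (ball_set1 d)); [right; exact: upto_upper_edge|].
by left; exact: below_lower_edge.
Qed.

(** A third member would be an edge of another ball shared with [below d] or [upto d], making some
    cut both an upper and a lower edge. *)
Lemma place_below (K : rcfType) (d : K) C : cut_place C = cut_place (below d) ->
  C = below d \/ C = upto d.
Proof.
have lb : is_lower_edge (below d).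
  by exists [set d]; [exact: ball_set1|exact: below_lower_edge].
have uu : is_upper_edge (upto d).
  by exists [set d]; [exact: ball_set1|exact: upto_upper_edge].
move=> E; have /cut_equiv_place/cut_equivP := E.
case=> [|[B HB [[_ e]|[e _]]]]; [by left|by case: (@edges_disjoint _ (below d)); first exists B|].
right; have uC : is_upper_edge C by exists B.
have /cut_equiv_place/cut_equivP : cut_place C = cut_place (upto d).
  by rewrite principal_place.
case=> [//|[B' HB' [[e' _]|[_ e']]]].
  by case: (edges_disjoint uC); exists B'.
by case: (edges_disjoint uu); exists B'.
Qed.

Section Converse.
Variables (R F : rcfType) (f : {rmorphism R -> F}).
Variable iota : (ratfun R -> option RR) -> (ratfun F -> option RR).
Hypothesis iotaM : forall z, Mset (ratfun R) z -> Mset (ratfun F) (iota z).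
Hypothesis iota_cont : Mcontinuous iota.
Hypothesis iota_res : forall z, Mset (ratfun R) z -> res f (iota z) = z.

Lemma iota_nbhd C g : Hp g (iota (cut_place C)) ->
  exists s, forall C', agree s C C' -> Hp g (iota (cut_place C')).
Proof.
move=> gC; have oU : Mopen (Mset (ratfun F) `&` Hp g).
  split=> [z []//|z [zM gz]]; exists [:: g]; split=> [b|z' z'M z'g].
    by rewrite inE => /eqP ->.
  by split=> //; apply: z'g; rewrite inE.
have [_ /interval_openP oV] := place_preimage_open (iota_cont oU).
have [|s sP] := oV C.
  by split; [exact: cut_placeP|split=> //; apply/iotaM/cut_placeP].
by exists s => C' /sP[_ []].
Qed.

Lemma iota_restrict C C0 : cut_place C0 = iota (cut_place C) ->
  cut_place (restrict_cut f C0) = cut_place C.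
Proof. by rewrite -res_place => ->; apply: iota_res; exact: cut_placeP. Qed.

(* If [C] is the lower edge of a ball around [c] and all cuts inducing [iota] of its
   place restrict to the upper edge, a positive unit [g] at such a cut separates it
   from all cuts below [c], which contradicts continuity along principal cuts
   d -> C with d < c. *)
Lemma iota_lift C : exists C',
  cut_place C' = iota (cut_place C) /\ restrict_cut f C' = C.
Proof.
have lift C' : exists C0, cut_place C0 = iota (cut_place C').
  by have /Mset_place[C0 ->] := iotaM (cut_placeP C'); exists C0.
have [C0 C0E] := lift C.
have [lC|nl] := pselect (is_lower_edge C).
  have [C1 C1E nu] := not_upper_edge_rep C0; rewrite C0E in C1E.
  have /cut_equiv_place/cut_equivP := iota_restrict C1E.
  case=> [|[B HB [[_ e]|[e1 e2]]]]; first by exists C1.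
    by case: (@edges_disjoint _ C) => //; exists B.
  have [c Bc] := ball_nonempty HB.
  have [g [g1 g2]] := separate_below nu (upper_edge_ball e1 Bc : lower C1 (f c)).
  have /iota_nbhd[s sP] : Hp g (iota (cut_place C)).
    by rewrite -C1E; exact/Hp_cut_place.
  have [d ds] := sameside_ex C (c :: s).
  have dc : d < c.
    by apply: (ds c (mem_head _ _)).2; exact: lower_edge_ball Bc.
  (* [below d] agrees with C on s, so g forces its image above f c, while the image restricts to
     [below d] or [upto d] with d < c. *)
  have [C2 C2E] := lift (below d).
  have C2c : lower (restrict_cut f C2) c.
    apply: g2; apply/Hp_cut_place; rewrite C2E; apply: sP => e es.
    have [|h1 h2] := ds e; first by rewrite inE es orbT.
    split=> [/h1//|/= ed]; apply: contrapT => /h2 de.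
    by have := lt_trans de ed; rewrite ltxx.
  have [E|E] := place_below (iota_restrict C2E); move: C2c; rewrite E /=; lra.
have [uC|nu] := pselect (is_upper_edge C); last first.
  have /cut_equiv_place/cut_equivP := iota_restrict C0E.
  case=> [|[B HB [[_ e]|[_ e]]]]; first by exists C0.
    by case: nu; exists B.
  by case: nl; exists B.
have [C1 C1E nC1] := not_lower_edge_rep C0; rewrite C0E in C1E.
have /cut_equiv_place/cut_equivP := iota_restrict C1E.
case=> [|[B HB [[e1 e2]|[_ e]]]]; first by exists C1.
  have [c Bc] := ball_nonempty HB.
  have [g [g1 g2]] := separate_above nC1 (lower_edge_ball HB e1 Bc : ~ lower C1 (f c)).
  have /iota_nbhd[s sP] : Hp g (iota (cut_place C)).
    by rewrite -C1E; exact/Hp_cut_place.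
  have [d ds] := sameside_ex C (c :: s).
  have cd : c < d.
    by apply: (ds c (mem_head _ _)).1; exact: upper_edge_ball Bc.
  have [C2 C2E] := lift (upto d).
  have C2c : ~ lower (restrict_cut f C2) c.
    apply: g2; apply/Hp_cut_place; rewrite C2E; apply: sP => e es.
    have [|h1 h2] := ds e; first by rewrite inE es orbT.
    split=> [/h1/ltW//|/= ed]; apply: contrapT => /h2 de.
    by have := lt_le_trans de ed; rewrite ltxx.
  have := iota_restrict C2E; rewrite principal_place => /place_below.
  by case=> E; case: C2c; rewrite E /=; lra.
by case: nl; exists B.
Qed.

(** Full sets are unions of fibres of [cut_place], so openness can be carried to places of F, pulled
    back by [iota], and returned to cuts. *)
Lemma lift_continuous (t : cut R -> cut F) :
  (forall C, cut_place (t C) = iota (cut_place C)) -> full_continuous t.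
Proof.
move=> tE U oU; have := place_preimage_open (iota_cont (place_image_open oU)).
congr full_open; apply/seteqP; split=> C /=.
  move=> [_ [C' UC' E]]; apply: (oU.1 _ _ UC'); apply/cut_equiv_place.
  by rewrite tE.
by move=> UC; split; [exact: cut_placeP|exists (t C)].
Qed.

(* A value [v a] between values of R but not in vR yields the ball of all b in R
   with v b > v a. Its edges are sent to the edges of a ball B' of F; according to
   whether a is in B', continuity fails from inside or from outside. *)
Lemma iota_vconvex (t : cut R -> cut F) :
  (forall C, cut_place (t C) = iota (cut_place C)) ->
  (forall C, restrict_cut f (t C) = C) -> vconvex f.
Proof.
move=> tE tres a b1 b2 b10 b20 a0 [n1 b1a] [n2 ab2]; apply: contrapT => nc.
have tresP C x : lower (t C) (f x) <-> lower C x by rewrite -{2}(tres C).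
have al0 : 0 < `|a| by rewrite normr_gt0.
(* If n|f x| exceeded |a| while |f x| <= |a|, then v(f x) = v(a), contrary to [nc]. *)
have scale x n : `|f x| <= `|a| -> n%:R * `|f x| <= `|a|.
  move=> xa; rewrite leNgt; apply/negP => ax; apply: nc; exists x; split; last split.
  - by apply: contraTneq ax => ->; rewrite rmorph0 normr0 mulr0 -leNgt.
  - by exists 1%N; rewrite mul1r.
  - by exists n; exact: ltW.
pose B := [set b : R | f `|b - 0| <= `|a|].
have BP x : B x <-> `|f x| <= `|a| by rewrite /B /= subr0 rcf_rmorph_norm.
have HB : is_ball B.
  apply: (@ball_symmetric _ (fun u => f u <= `|a|)) => [|u v /andP[_ uv] va|u u0].
  - by rewrite rmorph0.
  - by apply: le_trans va; rewrite rcf_rmorph_le.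
  - have fu : `|f u| = f u by rewrite -rcf_rmorph_norm ger0_norm.
    by have := scale u 2%N; rewrite fu rmorphM rmorph_nat; exact.
have B0 : B 0 by rewrite BP rmorph0 normr0 ltW.
have [C1 e1] := lower_edge_ex B; have [C2 e2] := upper_edge_ex B.
have C10 := lower_edge_ball HB e1 B0; have C20 := upper_edge_ball e2 B0.
have t10 : ~ lower (t C1) 0 by rewrite -(rmorph0 f) tresP.
have t20 : lower (t C2) 0 by rewrite -(rmorph0 f) tresP.
have : cut_place (t C1) = cut_place (t C2).
  by rewrite !tE; congr iota; apply: (edge_place HB); [left|right].
move=> /cut_equiv_place/cut_equivP[E|[B' HB' [[d1 d2]|[d1 d2]]]].
- by rewrite E in t10.
- have B'0 : B' 0 by apply/(between_edges _ HB' d1 d2).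
  have d2' : is_edge B' (t C2) by right.
  have [B'a|B'a] := pselect (B' `|a|).
    have B'Na : B' (- `|a|).
      by have := ball_reflect HB' B'0 B'a; congr B'; ring.
    have [g [g1 g2]] := separate_inside HB' d2' B'Na B'a.
    have /iota_nbhd[s sP] : Hp g (iota (cut_place C2)).
      by rewrite -tE; exact/Hp_cut_place.
    case: n2 ab2 => [|n2] ab2.
      by move: ab2; rewrite mul0r normr_le0 fmorph_eq0 (negPf b20).
    have n20 : 0 < n2.+1%:R :> F by rewrite ltr0n.
    (* A positive element of B, added to s so that the bound l is positive and 2b > l for every b >=
       l. *)
    pose u := `|b2| / n2.+1%:R.
    have u0 : 0 < u by rewrite divr_gt0 ?normr_gt0 ?ltr0n.
    have Bu : B u.
      rewrite BP -rcf_rmorph_norm gtr0_norm // fmorph_div rmorph_nat rcf_rmorph_norm.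
      by rewrite ler_pdivrMr // mulrC.
    have [l [v [lP _]]] := seq_lower_bounds (u :: s) C2.
    have [C2l ul] := lP u (mem_head _ _) (upper_edge_ball e2 Bu).
    have [b Bb lb] := (upper_edgeP e2 _).1 C2l.
    have B2b : B (2 * b) by have := ball_reflect HB Bb B0; congr B; ring.
    have C22b := upper_edge_ball e2 B2b.
    have fb : f (2 * b) <= `|a| by apply: le_trans (ler_norm _) _; exact/BP.
    (* [below (2 * b)] agrees with C2 on s, so g is a unit at its image. That image contains -|a|,
       hence |a| by the choice of g, yet it excludes f(2b) <= |a|. *)
    have : lower (t (below (2 * b))) `|a|.
      apply: g2; last first.
        apply: (@lower_le _ _ _ (f (- (2 * b)))); first by rewrite rmorphN lerN2.
        by apply/tresP => /=; lra.
      apply/Hp_cut_place; rewrite tE; apply: sP => e es.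
      split=> [C2e|/= ed]; last exact: lower_le (ltW ed) C22b.
      by have [|_ el] := lP e _ C2e; rewrite ?inE ?es ?orbT //=; lra.
    by move=> /(lower_le fb)/tresP /=; rewrite ltxx.
  have nl : ~ is_lower_edge (t C2) by apply: edges_disjoint; exists B'.
  have t2a : ~ lower (t C2) `|a|.
    move=> t2a; apply: B'a; apply/(between_edges _ HB' d1 d2); split=> //.
    by move=> /(lower_le (ltW al0)).
  have [g [g1 g2]] := separate_above nl t2a.
  have /iota_nbhd[s sP] : Hp g (iota (cut_place C2)).
    by rewrite -tE; exact/Hp_cut_place.
  (* From |a| <= n1 |f b1| one more multiple of b1 is strictly too large, so (n1 + 1) b1 lies
     outside B. *)
  have nT : B <> setT.
    move=> BT; have : B (n1.+1%:R * b1) by rewrite BT.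
    rewrite BP rmorphM rmorph_nat normrM ger0_norm ?ler0n // -natr1 mulrDl mul1r.
    have : 0 < `|f b1| by rewrite normr_gt0 fmorph_eq0.
    by move: b1a; set w := n1%:R * _; lra.
  have [[e0 C2e0] nmin] := upper_edge_no_min HB nT e2.
  have [l [v [_ vP]]] := seq_lower_bounds (e0 :: s) C2.
  have [C2v _] := vP e0 (mem_head _ _) C2e0.
  have [d C2d dv] := nmin _ C2v.
  have d0 : 0 < d := lower_lt C20 C2d.
  have ad : `|a| < f d.
    rewrite ltNge; apply/negP => da; apply: C2d; apply: (upper_edge_ball e2).
    by rewrite BP -rcf_rmorph_norm gtr0_norm.
  (* Here d lies above B but close to C2, so g keeps the image of [upto d] below |a|, while it
     contains f d > |a|. *)
  have : ~ lower (t (upto d)) `|a|.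
    apply: g2; apply/Hp_cut_place; rewrite tE; apply: sP => e es.
    split=> [C2e|/= ed]; first exact: ltW (lower_lt C2e C2d).
    apply: contrapT => C2e.
    have [|_ ve] := vP e _ C2e; first by rewrite inE es orbT.
    by have := lt_le_trans dv (le_trans ve ed); rewrite ltxx.
  by case; apply: (lower_le (ltW ad)); apply/tresP => /=.
have [b B'b] := ball_nonempty HB'.
have /ltW b0 := (lower_edgeP d2 0).1 t20 _ B'b.
by case: t10; apply: lower_le b0 _; exact: upper_edge_ball B'b.
Qed.

End Converse.

Unset Implicit Arguments.

Theorem theorem5p1 (R F : rcfType) (f : {rmorphism R -> F}) :
  (vconvex f ->
   exists iota : (ratfun R -> option RR) -> (ratfun F -> option RR),
     (forall t : cut R -> cut F, admissible f t ->
        forall C : cut R, iota (lam (chi C)) = lam (chi (t C))) /\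
     (forall z, Mset (ratfun R) z -> exists C : cut R, z = lam (chi C)) /\
     (forall z, Mset (ratfun R) z -> Mset (ratfun F) (iota z)) /\
     (forall z1 z2, Mset (ratfun R) z1 -> Mset (ratfun R) z2 ->
        iota z1 = iota z2 -> z1 = z2) /\
     Mcontinuous iota /\
     (forall z, Mset (ratfun R) z -> res f (iota z) = z))
  /\
  (forall iota : (ratfun R -> option RR) -> (ratfun F -> option RR),
     (forall z, Mset (ratfun R) z -> Mset (ratfun F) (iota z)) ->
     (forall z1 z2, Mset (ratfun R) z1 -> Mset (ratfun R) z2 ->
        iota z1 = iota z2 -> z1 = z2) ->
     Mcontinuous iota ->
     (forall z, Mset (ratfun R) z -> res f (iota z) = z) ->
     (exists t : cut R -> cut F,
        injective t /\ full_continuous t /\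
        (forall C, cut_res f (t C) = lower C) /\
        (forall C, lam (chi (t C)) = iota (lam (chi C)))) /\
     vconvex f).
Proof.
split=> [vcf|iota iotaM iota_inj iota_cont iota_res].
  have [iota [iotaE iota_cont iotaM iota_res]] := extend_places vcf.
  exists iota; split; last split; last split; last split; last split=> //.
  - by move=> t tP C; rewrite !chiE; exact: iotaE.
  - by move=> z /Mset_place[C ->]; exists C; rewrite chiE.
  - exact: iotaM.
  (* Restriction is a left inverse of [iota]. *)
  - by move=> z1 z2 M1 M2 E; rewrite -(iota_res _ M1) E iota_res.
have /choice[t tP] := iota_lift iotaM iota_cont iota_res.
have tE C : cut_place (t C) = iota (cut_place C) by case: (tP C).
have tres C : restrict_cut f (t C) = C by case: (tP C).
split; last exact: (iota_vconvex iotaM iota_cont tE tres).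
exists t; split; last split; last split.
- by move=> C C' E; rewrite -(tres C) E.
- exact: (lift_continuous iota_cont tE).
- by move=> C; rewrite -[in RHS](tres C).
- by move=> C; rewrite !chiE; exact: tE.
Qed.
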